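(* Let $\Omega=(0,1)\times(0,1)$ and consider the system ${}^{C}\mathcal D_{0^+}^{0.5}u=\partial_{y_1}^2u+\partial_{y_2}^2u$ in $\Omega\times[0,2]$, $u=0$ on $\partial\Omega\times[0,2]$, $u(\cdot,0)=u_0$, with output $z(t)=\int_0^1u(\tfrac12,y_2,t)\sin(2\pi y_2)\,dy_2$. Let $$h(y_1,y_2)=\frac1{4\pi}\Big(\cos(\pi y_1)\sin(4\pi y_2),\ \tfrac14\sin(\pi y_1)\cos(4\pi y_2)\Big).$$ Then the gradient $h$ is not approximately $G$-observable in $\Omega$, but it is approximately $G$-observable in $\omega=(0,1)\times(\tfrac18,\tfrac58)$.
   Context: Write $E=L^2(\Omega)$. ${}^{C}\mathcal D_{0^+}^{\alpha}u(\cdot,t)=\int_0^t\frac{(t-e)^{-\alpha}}{\Gamma(1-\alpha)}\partial_eu(\cdot,e)\,de$ is the Caputo derivative, and $E_{0.5}(z)=\sum_{k\ge0}z^k/\Gamma(0.5k+1)$ is the Mittag-Leffler function. Put $\lambda_{i,j}=(i^2+j^2)\pi^2$, $\varphi_{i,j}(y_1,y_2)=2\sin(i\pi y_1)\sin(j\pi y_2)$ for $i,j\ge1$. The output of the mild solution with initial state $v$ is $$\mathcal K_\alpha(t)v=\sum_{i,j=1}^{\infty}E_{0.5}(-\lambda_{i,j}t^{0.5})\,\langle v,\varphi_{i,j}\rangle_E\int_0^1\varphi_{i,j}(\tfrac12,y_2)\sin(2\pi y_2)\,dy_2 ,\qquad t\in[0,2].$$ $\nabla:H_0^1(\Omega)\subset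 E\to E^2$ is the gradient and $\nabla^*=-\operatorname{div}$ its adjoint. For $\omega\subset\Omega$, $\chi_\omega^2:E^2\to (L^2(\omega))^2$ is restriction to $\omega$ and $(\chi_\omega^2)^*$ is extension by $0$ to $\Omega$. Terminology for the element $h\in E^2$: $h$ is not approximately $G$-observable in $\Omega$ means that $h\in\operatorname{Ker}(\mathcal K_\alpha(t)\nabla^* )$ for all $t\in[0,2]$; $h$ is approximately $G$-observable in $\omega$ means that $h\notin\operatorname{Ker}\big(\mathcal K_\alpha(t)\nabla^*(\chi_\omega^2)^*\chi_\omega^2\big)$ for all $t\in[0,2]$. *)

(* Defs.v *)
From mathcomp Require Import all_boot all_order all_algebra.
From mathcomp Require Import all_classical all_reals all_analysis.

Set Implicit Arguments.
Unset Strict Implicit.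
Unset Printing Implicit Defensive.

Import Order.TTheory GRing.Theory Num.Theory.
Import numFieldNormedType.Exports.

Local Open Scope classical_set_scope.
Local Open Scope ring_scope.

(** Functions on a subset of the plane are represented by functions on
    [R * R], of which only the values on that subset matter; an element of an
    L^2 space is represented by any member of its a.e.-equality class. *)

Section Plane.
Variable R : realType.
Implicit Types (f y w : R * R -> R) (g p : (R * R -> R) * (R * R -> R)).

Local Notation leb2 :=
  (@lebesgue_measure R \x @lebesgue_measure R)%E.

Definition Omega : set (R * R) := `]0, 1[%classic `*` `]0, 1[%classic.

(** L^2(Omega), through extension by zero to the plane. *)
Definition in_E f : Prop := f \_ Omega \in Lfun leb2 2%:E.
Definition in_E2 p : Prop := in_E p.1 /\ in_E p.2.

Definition innerE f1 f2 : R := \int[leb2]_(x in Omega) (f1 x * f2 x).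
Definition innerE2 p1 p2 : R := innerE p1.1 p2.1 + innerE p1.2 p2.2.

Definition cvg_E (u : (R * R -> R)^nat) f : Prop :=
  ('N[leb2]_2%:E[EFin \o ((u n \- f)%R \_ Omega)] @[n --> \oo] --> 0)%E.

Definition dir1 : R * R := (1, 0).
Definition dir2 : R * R := (0, 1).

Definition partial1 f : R * R -> R := fun x => 'D_dir1 f x.
Definition partial2 f : R * R -> R := fun x => 'D_dir2 f x.

(** The iterated partial derivative of [f] along a word of directions;
    [true] stands for the first variable. *)
Definition iter_partial (s : seq bool) f : R * R -> R :=
  foldr (fun b k => if b then partial1 k else partial2 k) f s.

Definition smooth f : Prop := forall s : seq bool,
  continuous (iter_partial s f) /\
  forall x, derivable (iter_partial s f) x dir1 /\
            derivable (iter_partial s f) x dir2.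

(** C_c^oo(Omega) *)
Definition test_function f : Prop :=
  smooth f /\
  exists K : set (R * R),
    [/\ compact K, K `<=` Omega & forall x, ~ K x -> f x = 0].

Definition weak_gradient y g : Prop :=
  forall u, test_function u ->
    innerE y (partial1 u) = - innerE g.1 u /\
    innerE y (partial2 u) = - innerE g.2 u.

(** Graph of the unbounded operator nabla : H_0^1(Omega) in E -> E^2, where
    H_0^1(Omega) is the closure of C_c^oo(Omega) in H^1(Omega): [y] is in
    H^1(Omega) with weak gradient [g], and is an H^1-limit of test functions. *)
Definition nabla y g : Prop :=
  [/\ in_E y, in_E2 g, weak_gradient y g &
    exists u : (R * R -> R)^nat,
      [/\ forall n, test_function (u n), cvg_E u y,
          cvg_E (fun n => partial1 (u n)) g.1 &
          cvg_E (fun n => partial2 (u n)) g.2]].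

(** Graph of the Hilbert-space adjoint of [nabla]: [nabla_adj p w] means that
    [p] is in the domain of the adjoint, with image [w]. *)
Definition nabla_adj p w : Prop :=
  [/\ in_E2 p, in_E w &
    forall y g, nabla y g -> innerE2 g p = innerE y w].

(** Restriction to [A] followed by extension by zero, on E^2. *)
Definition chi_adj_chi (A : set (R * R)) p :
    (R * R -> R) * (R * R -> R) :=
  (p.1 \_ A, p.2 \_ A).

End Plane.

Section Output.
Variable R : realType.
Implicit Types (alpha t : R) (v : R * R -> R)
  (p : (R * R -> R) * (R * R -> R)).

Definition Gamma (x : R) : R :=
  \int[lebesgue_measure]_(s in `]0, +oo[) (s `^ (x - 1) * expR (- s)).

Definition mittag_leffler alpha (z : R) : R :=
  limn (series (fun k => z ^+ k / Gamma (alpha * k%:R + 1))).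

Definition lambda (i j : nat) : R := (i ^ 2 + j ^ 2)%:R * pi ^+ 2.

Definition phi (i j : nat) : R * R -> R :=
  fun y => 2 * sin (i%:R * pi * y.1) * sin (j%:R * pi * y.2).

Definition output v : R :=
  \int[lebesgue_measure]_(y2 in `[0, 1]) (v (2^-1, y2) * sin (2 * pi * y2)).

Definition K_partial alpha t v (mn : nat * nat) : R :=
  \sum_(1 <= i < mn.1.+1) \sum_(1 <= j < mn.2.+1)
    mittag_leffler alpha (- (lambda i j * t `^ alpha))
    * innerE v (phi i j) * output (phi i j).

(** Graph of K_alpha(t). The double series is the limit of its rectangular
    partial sums as both bounds tend to infinity independently. *)
Definition Kalpha alpha t v (z : R) : Prop :=
  K_partial alpha t v mn @[mn --> filter_prod \oo \oo] --> z.

(** Graph of K_alpha(t) nabla^*. *)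
Definition K_nabla_adj alpha t p (z : R) : Prop :=
  exists w, nabla_adj p w /\ Kalpha alpha t w z.

Definition in_dom alpha t p : Prop := exists z, K_nabla_adj alpha t p z.
Definition in_ker alpha t p : Prop := K_nabla_adj alpha t p 0.

Definition not_approx_G_observable_Omega alpha (T : R) p : Prop :=
  forall t, 0 <= t <= T -> in_ker alpha t p.

(** The operator is unbounded: being outside its kernel is only meaningful for
    an element of its domain, hence the first conjunct, without which every
    element outside the domain would count as observable. *)
Definition approx_G_observable alpha (T : R) (A : set (R * R)) p : Prop :=
  forall t, 0 <= t <= T ->
    in_dom alpha t (chi_adj_chi A p) /\ ~ in_ker alpha t (chi_adj_chi A p).

Definition h : (R * R -> R) * (R * R -> R) :=
  (fun y => (4 * pi)^-1 * (cos (pi * y.1) * sin (4 * pi * y.2)),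
   fun y => (4 * pi)^-1 * (4^-1 * (sin (pi * y.1) * cos (4 * pi * y.2)))).

Definition omega : set (R * R) :=
  `]0, 1[%classic `*` `]8^-1, 5 / 8[%classic.

End Output.

Arguments omega R : clear implicits.

(* Main.v *)
Require Import Defs.
From mathcomp Require Import all_boot all_order all_algebra.
From mathcomp Require Import all_classical all_reals all_analysis.
From mathcomp Require Import measurable_realfun ring lra.

Set Implicit Arguments.
Unset Strict Implicit.
Unset Printing Implicit Defensive.

Import Order.TTheory GRing.Theory Num.Theory.
Import numFieldNormedType.Exports.

Local Open Scope classical_set_scope.
Local Open Scope ring_scope.

(** The adjoint of the gradient is minus the divergence, and
    [- div h = sin(pi y1) sin(4 pi y2) / 2].  The vector field [h 1_A] with
    [A = (0,1) x (c,d)] has a divergence without singular part as soon as its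
    normal component [h.2] vanishes on the inner sides [y2 = c], [y2 = d];
    since [h.2] contains the factor [cos(4 pi y2)], this holds for
    [c = 1/8], [d = 5/8], while for [A = Omega] no condition is needed because
    functions of [H_0^1] vanish on the boundary.  So in both cases
    [nabla^*(h 1_A)] is [w = 1_A sin(pi y1) sin(4 pi y2) / 2]
    ([nabla_adj_rect], [nabla_adj_h_rect]).

    The output of [phi i j] vanishes unless [j = 2], and [w] is orthogonal to
    [phi i 2] unless [i = 1]; hence the double series reduces to
    [E_{1/2}(- 5 pi^2 t^{1/2}) <w, phi 1 2>] ([cvg_Kalpha]).  On [Omega] the
    factor [<w, phi 1 2>] contains the integral of [sin(4 pi s) sin(2 pi s)]
    over [(0,1)], which is zero.  On [omega] that integral, taken over
    [(1/8, 5/8)], is [- sqrt 2 / (6 pi)] ([sin_sin_prim_omega_neq0]), so what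
    remains is [E_{1/2}(-x) > 0] for [x >= 0] ([mittag_leffler_gt0]).

    With [x^2 = T], the even terms of [E_{1/2}(-x)] add up to [e^T].  The
    recurrence of the upper incomplete gamma function, obtained by integration
    by parts, identifies [e^-T] times the sum of the odd terms, up to the first
    one, with an increase of the normalized function [gammaQ], which never
    exceeds [1]; a strict lower bound on [gammaQ (3/2) T] takes care of the
    first term.

    Elements of the graph of the adjoint are only determined almost everywhere,
    so membership in the kernel speaks of every image [w'] of [h 1_A].  Any two
    images have the same inner products with test functions, hence with
    [phi i j], which is the bounded pointwise limit of test functions obtained
    from smooth cutoffs ([nabla_adj_inner_unique]). *)

(** * The upper incomplete gamma function *)

Section UpperGamma.
Context {R : realType}.
Implicit Types (a b r s x T : R) (n m k : nat).
Local Notation mu := (@lebesgue_measure R).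

Lemma derivable_LR_powR r a b : 0 <= r -> 0 <= a -> a < b ->
  derivable_oo_LRcontinuous (fun s : R => s `^ r) a b.
Proof.
move=> r0 a0 ab.
have dpos x : 0 < x -> derivable (fun s : R => s `^ r) x 1.
  by move=> x0; apply: derivable_powR; rewrite in_itv/= x0.
have cpos x : 0 < x -> {for x, continuous (fun s : R => s `^ r)}.
  by move=> x0; apply: differentiable_continuous; apply/derivable1_diffP; exact: dpos.
split.
- by move=> x; rewrite in_itv/= => /andP[ax _]; apply: dpos; exact: le_lt_trans ax.
- move: a0; rewrite le_eqVlt => /predU1P[<-|a0]; last first.
    by apply: cvg_at_right_filter; exact: cpos.
  move: r0; rewrite le_eqVlt => /predU1P[<-|r0].
    have -> : (fun s : R => s `^ 0) = cst 1.
      by apply/funext => s; rewrite powRr0.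
    by rewrite powRr0; exact: cvg_cst.
  by rewrite /= powR0 ?gt_eqF//; exact: powR_cvg0.
- by apply: cvg_at_left_filter; apply: cpos; exact: le_lt_trans ab.
Qed.

Definition gamma_density a s : R := s `^ (a - 1) * expR (- s).

Definition upper_gamma a T : \bar R :=
  (\int[mu]_(s in `[T, +oo[) (gamma_density a s)%:E)%E.

Lemma gamma_density_ge0 a s : 0 <= gamma_density a s.
Proof. by rewrite mulr_ge0 ?powR_ge0 ?expR_ge0. Qed.

Lemma measurable_gamma_density a (D : set R) :
  measurable_fun D (gamma_density a).
Proof.
apply: measurable_funM; first exact: measurable_funTS (measurable_powR _).
by apply: measurableT_comp => //; exact: measurable_funTS.
Qed.

Lemma continuous_expRN : continuous (fun s : R => expR (- s)).
Proof.
by move=> s; apply: (@continuous_comp _ _ _ -%R expR); [exact: oppr_continuous|exact: continuous_expR].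
Qed.

Lemma is_derive_expRN s : is_derive s 1 (fun s => expR (- s)) (- expR (- s)).
Proof.
rewrite -[- expR _]mulrN1.
exact: (is_derive1_comp (is_derive_expR (- s)) (is_deriveNid s 1)).
Qed.

Lemma derivable_LR_powR_expRN r a b : 0 <= r -> 0 <= a -> a < b ->
  derivable_oo_LRcontinuous (fun s => s `^ r * expR (- s)) a b.
Proof.
move=> r0 a0 ab; have [d l u] := derivable_LR_powR r0 a0 ab.
split.
- by move=> x /d dx; apply: derivableM => //; exact: ex_derive (is_derive_expRN x).
- by apply: cvgM => //; apply: cvg_at_right_filter; exact: continuous_expRN.
- by apply: cvgM => //; apply: cvg_at_left_filter; exact: continuous_expRN.
Qed.

Lemma within_continuous_gamma_density r a b : 1 <= r -> 0 <= a -> a < b ->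
  {within `[a, b], continuous (gamma_density r)}.
Proof.
by move=> r1 a0 ab; apply: derivable_oo_LRcontinuous_within;
   apply: derivable_LR_powR_expRN => //; rewrite subr_ge0.
Qed.

(** For [x >= 1] the exponential series gives [x^m e^-x <= (m+1)! / x]. *)
Lemma cvg_powR_expRN r : (x `^ r * expR (- x)) @[x --> +oo] --> (0 : R).
Proof.
pose m := (Num.truncn `|r|).+1.
have rm : r <= m%:R by rewrite (le_trans (ler_norm _))// ltW// truncnS_gt.
apply: (@squeeze_cvgr _ _ _ _ (cst 0) (fun x => m.+1`!%:R * x^-1)).
- near=> x; rewrite mulr_ge0 ?powR_ge0 ?expR_ge0//=.
  have x1 : 1 <= x by near: x; exact: nbhs_pinfty_ge.
  have x0 : 0 < x by exact: lt_le_trans x1.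
  rewrite expRN ler_pdivrMr ?expR_gt0//.
  rewrite (@le_trans _ _ (x ^+ m))//.
    by rewrite -powR_mulrn ?(ltW x0)//; exact: (ler_powR x1 rm).
  rewrite mulrAC ler_pdivlMr// -exprSr mulrC -ler_pdivrMr ?ltr0n ?fact_gt0//.
  by rewrite (le_trans _ (expR_ge1Dxn m (ltW x0)))// lerDr.
- exact: cvg_cst.
- rewrite -[X in _ --> X](mulr0 (m.+1`!%:R)).
  apply: cvgM; first exact: cvg_cst.
  by apply/gtr0_cvgV0 => //; near=> x; near: x; exact: nbhs_pinfty_gt.
Unshelve. all: by end_near. Qed.

Lemma upper_gamma_ge0 a T : (0 <= upper_gamma a T)%E.
Proof. by apply: integral_ge0 => s _; rewrite lee_fin gamma_density_ge0. Qed.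

Lemma cvg_upper_gamma a T :
  (\int[mu]_(s in `[T, (T + n.+1%:R)%R]) (gamma_density a s)%:E @[n --> \oo]
   --> upper_gamma a T)%E.
Proof.
rewrite (cvg_shiftS (fun n => \int[mu]_(s in `[T, (T + n%:R)%R]) (gamma_density a s)%:E)%E).
rewrite /upper_gamma itv_bndy_bigcup_BRight.
apply: ge0_nondecreasing_set_cvg_integral => //.
- move=> m n mn; rewrite subsetEset; apply: subset_itvl.
  by rewrite bnd_simp lerD2l ler_nat.
- by move=> i; apply/measurable_EFinP; exact: measurable_gamma_density.
- by move=> i x _; rewrite lee_fin gamma_density_ge0.
Qed.

(** Integration by parts of [s^a e^-s] on [[T, T + n + 1]], then [n] to
    infinity.  Taking [T = 0] gives the functional equation of [Gamma], and
    [T > 0] the increments of its normalized tail.  The restriction [1 <= a]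
    keeps the integrand continuous at [0]. *)
Lemma upper_gammaS a T : 1 <= a -> 0 <= T ->
  upper_gamma (a + 1) T =
  ((T `^ a * expR (- T))%:E + a%:E * upper_gamma a T)%E.
Proof.
move=> a1 T0.
have a0 : 0 <= a by exact: le_trans a1.
pose F s : R := s `^ a * expR (- s).
pose I b n := (\int[mu]_(s in `[T, (T + n.+1%:R)%R]) (gamma_density b s)%:E)%E.
have TT n : T < T + n.+1%:R by rewrite ltrDl.
have iI b n : 1 <= b ->
    mu.-integrable `[T, (T + n.+1%:R)%R] (EFin \o gamma_density b).
  move=> b1; apply: continuous_compact_integrable; first exact: segment_compact.
  exact: within_continuous_gamma_density.
have parts n : I (a + 1)%R n =
    ((F T)%:E + a%:E * I a n - (F (T + n.+1%:R))%:E)%E.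
  have a11 : 1 <= a + 1 by rewrite lerDr.
  have FTC : (\int[mu]_(s in `[T, (T + n.+1%:R)%R])
      (a * gamma_density a s - gamma_density (a + 1) s)%:E =
      (F (T + n.+1%:R))%:E - (F T)%:E)%E.
    apply: continuous_FTC2 => //.
    - move=> x; apply: cvgB.
        by apply: cvgZr; exact: within_continuous_gamma_density.
      exact: within_continuous_gamma_density.
    - exact: derivable_LR_powR_expRN.
    - move=> x /[!in_itv]/= /andP[Tx _].
      have x0 : 0 < x by exact: le_lt_trans Tx.
      rewrite derive1E.
      have dF : is_derive x 1 F
        (x `^ a *: (- expR (- x)) + expR (- x) *: (a * x `^ (a - 1))).
        apply: is_deriveM; first exact: is_derive1_powR.
        exact: is_derive_expRN.
      rewrite (@derive_val _ _ _ _ _ _ _ dF) /gamma_density addrK /GRing.scale/=.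
      by ring.
  have iIf b : 1 <= b -> I b n \is a fin_num.
    by move=> b1; apply: integrable_fin_num => //; exact: iI.
  move: FTC.
  rewrite [X in X = _ -> _](_ : _ = a%:E * I a n - I (a + 1)%R n)%E; last first.
    have <- : (\int[mu]_(s in `[T, (T + n.+1%:R)%R]) (a * gamma_density a s)%:E =
        a%:E * I a n)%E.
      by rewrite /I -integralZl//; exact: iI.
    rewrite /I -integralB_EFin//; last exact: iI.
    exact: (integrableZl _ a (iI a n a1)).
  rewrite -(fineK (iIf _ a1)) -(fineK (iIf _ a11)) => -[E].
  by rewrite -!EFinM -!EFinD; congr EFin; lra.
have cI b : I b n @[n --> \oo] --> upper_gamma b T by exact: cvg_upper_gamma.
apply: (cvg_unique (@ereal_hausdorff R) (cI (a + 1))).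
suff : I (a + 1)%R n @[n --> \oo] -->
    ((F T)%:E + a%:E * upper_gamma a T - 0)%E by rewrite sube0.
rewrite (funext parts).
apply: cvgeB; first by rewrite fin_num_adde_defl.
- apply: cvgeD; [by rewrite fin_num_adde_defr|exact: cvg_cst|].
  by apply: cvgeZl.
- apply: cvg_EFin; first by near=> n.
  have Tn : (T + n.+1%:R) @[n --> \oo] --> +oo%R.
    apply/cvgryPge => M; near=> n; rewrite -lerBlDl (le_trans _ (_ : n%:R <= _))//.
      by near: n; exact: nbhs_infty_ger.
    by rewrite ler_nat.
  exact: (cvg_comp _ _ Tn (cvg_powR_expRN a)).
Unshelve. all: by end_near. Qed.

Lemma upper_gamma0E a : Gamma a = fine (upper_gamma a 0).
Proof.
rewrite /Gamma /Rintegral /upper_gamma integral_itv_obnd_cbnd//.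
by apply/measurable_EFinP; exact: measurable_gamma_density.
Qed.

Lemma is_derive_NexpRN s : is_derive s 1 (fun s => - expR (- s)) (expR (- s)).
Proof.
apply: is_derive_eq (opprK _).
exact: (is_deriveN (is_derive_expRN s)).
Qed.

Lemma upper_gamma1 T : upper_gamma 1 T = (expR (- T))%:E.
Proof.
have := @ge0_continuous_FTC2y R (fun s => expR (- s)) (fun s => - expR (- s)) T 0.
rewrite sub0e -EFinN opprK => <-.
- apply: eq_integral => s _.
  by rewrite /gamma_density subrr powRr0 mul1r.
- by move=> x _; exact: expR_ge0.
- by apply: continuous_subspaceT; exact: continuous_expRN.
- by rewrite -oppr0; apply: cvgN; exact: cvgr_expR.
- by move=> x _; have dx := @ex_derive _ _ _ _ _ _ _ (is_derive_NexpRN x); exact dx.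
- by apply: cvg_at_right_filter; apply: cvgN; exact: continuous_expRN.
- move=> x _; rewrite derive1E.
  by rewrite (@derive_val _ _ _ _ _ _ _ (is_derive_NexpRN x)).
Qed.

Lemma upper_gamma_fact n : upper_gamma n.+1%:R 0 = n`!%:R%:E.
Proof.
elim: n => [|n IH]; first by rewrite upper_gamma1 oppr0 expR0.
rewrite -natr1 upper_gammaS ?ler1n// IH powR0 ?pnatr_eq0// mul0r add0e.
by rewrite -EFinM -natrM.
Qed.

Lemma upper_gamma_le0 a T : 0 <= T -> (upper_gamma a T <= upper_gamma a 0)%E.
Proof.
move=> T0; apply: ge0_subset_integral => //.
- by apply/measurable_EFinP; exact: measurable_gamma_density.
- by move=> s _; rewrite lee_fin gamma_density_ge0.
- by apply: subset_itvr; rewrite bnd_simp.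
Qed.

(** Finiteness is needed since a divergent integral has real value [0]: the
    density is dominated by [(1 + s^n) e^-s], whose integral is [1 + n!]. *)
Lemma upper_gamma0_fin a : 1 <= a -> upper_gamma a 0 \is a fin_num.
Proof.
move=> a1; pose n := (Num.truncn `|a - 1|).+1.
have an : a - 1 <= n%:R by rewrite (le_trans (ler_norm _))// ltW// truncnS_gt.
rewrite ge0_fin_numE ?upper_gamma_ge0//.
apply: (@le_lt_trans _ _ (upper_gamma 1 0 + upper_gamma n.+1%:R 0)%E); last first.
  by rewrite upper_gamma1 upper_gamma_fact -EFinD ltry.
have mE b : measurable_fun `[(0:R), +oo[ (fun s => (gamma_density b s)%:E).
  by apply/measurable_EFinP; exact: measurable_gamma_density.
have g0 b s : (0 <= (gamma_density b s)%:E)%E.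
  by rewrite lee_fin gamma_density_ge0.
rewrite /upper_gamma -ge0_integralD//; [|exact: mE|exact: mE].
apply: ge0_le_integral => //.
- exact: mE.
- by apply: emeasurable_funD; exact: mE.
move=> s /=; rewrite in_itv/= andbT => s0.
rewrite -EFinD lee_fin -mulrDl ler_wpM2r ?expR_ge0//.
rewrite subrr powRr0 -natr1 addrK.
have [s1|s1] := leP 1 s.
  by rewrite (le_trans (ler_powR s1 an))// lerDr.
rewrite (@le_trans _ _ 1) ?lerDl ?powR_ge0//.
have E1 : (1 : R) `^ (a - 1) = 1 by rewrite powR1.
(* below 1 the density is dominated by the constant term *)
rewrite -[leRHS]E1 ge0_ler_powR ?subr_ge0// ?nnegrE ?ler01//.
exact: ltW.
Qed.

Lemma upper_gamma_fin a T : 1 <= a -> 0 <= T -> upper_gamma a T \is a fin_num.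
Proof.
move=> a1 T0; rewrite ge0_fin_numE ?upper_gamma_ge0//.
apply: le_lt_trans (upper_gamma_le0 a T0) _.
by rewrite -ge0_fin_numE ?upper_gamma_ge0// upper_gamma0_fin.
Qed.

Lemma GammaS a : 1 <= a -> Gamma (a + 1) = a * Gamma a.
Proof.
move=> a1; rewrite !upper_gamma0E upper_gammaS// powR0; last first.
  by rewrite gt_eqF// (lt_le_trans ltr01).
by rewrite mul0r add0e -(fineK (upper_gamma0_fin a1)).
Qed.

Lemma Gamma_fact n : Gamma n.+1%:R = n`!%:R :> R.
Proof. by rewrite upper_gamma0E upper_gamma_fact. Qed.

(** On [[T, +oo[] the factor [s^(a-1)] is at least [T^(a-1)], and
    [e^-s] has integral [e^-T].  Strictness comes from [[T + 1, +oo[], where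
    [s^(a-1)] is at least [(T+1)^(a-1)]. *)
Lemma upper_gamma_gt a T : 1 < a -> 0 <= T ->
  ((T `^ (a - 1) * expR (- T))%:E < upper_gamma a T)%E.
Proof.
move=> a1 T0.
have a1' : 1 <= a by exact: ltW.
have mE b (D : set R) : measurable_fun D (fun s => (gamma_density b s)%:E).
  by apply/measurable_EFinP; exact: measurable_gamma_density.
have g0 b s : (0 <= (gamma_density b s)%:E)%E.
  by rewrite lee_fin gamma_density_ge0.
have scale c (D : set R) : measurable D -> 0 <= c -> (forall s, D s -> c <= s) ->
    ((c `^ (a - 1))%:E * \int[mu]_(s in D) (gamma_density 1 s)%:E
     <= \int[mu]_(s in D) (gamma_density a s)%:E)%E.
  move=> mD c0 cD; rewrite -ge0_integralZl_EFin ?powR_ge0//; last exact: mE.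
  apply: ge0_le_integral => //.
  - by move=> s _; rewrite mule_ge0// lee_fin powR_ge0.
  - by apply: measurable_funeM; exact: mE.
  - exact: mE.
  - move=> s Ds; rewrite -EFinM lee_fin /gamma_density subrr powRr0 mul1r.
    rewrite ler_wpM2r ?expR_ge0//.
    have := cD _ Ds => cs.
    by rewrite ge0_ler_powR ?subr_ge0 ?nnegrE// (le_trans c0).
(* gaining on the second piece only is enough for strictness *)
pose D1 : set R := `[T, (T + 1)%R[%classic.
pose D2 : set R := `[(T + 1)%R, +oo[%classic.
have D12 : `[T, +oo[%classic = D1 `|` D2.
  by rewrite /D1 /D2 -itv_bndbnd_setU// ?bnd_simp// lerDl.
have dD : [disjoint D1 & D2].
  rewrite disj_set2E; apply/eqP/seteqP; split => s//=.
  by rewrite /D1 /D2/= !in_itv/= andbT => -[/andP[_ sT]]; rewrite leNgt sT.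
have splitU b : upper_gamma b T = (\int[mu]_(s in D1) (gamma_density b s)%:E +
    upper_gamma b (T + 1))%E.
  rewrite [LHS]/upper_gamma D12 ge0_integral_setU//; [exact: measurable_itv|exact: measurable_itv|exact: mE].
have sc1 := scale T D1 (measurable_itv _) T0.
have sc2 := scale (T + 1) D2 (measurable_itv _).
move: (splitU 1); rewrite !upper_gamma1 splitU.
set A := (X in (_ = X + _)%E -> _) => AE.
have Afin : A \is a fin_num.
  by move: AE; case: A.
move: AE; rewrite -(fineK Afin) -EFinD => -[AE].
apply: (@lt_le_trans _ _ ((T `^ (a - 1))%:E * A + ((T + 1) `^ (a - 1))%:E * upper_gamma 1 (T + 1))%E); last first.
  apply: leeD.
  - by apply: sc1 => s; rewrite /D1/= in_itv/= => /andP[].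
  - apply: sc2; first by rewrite addr_ge0.
    by move=> s; rewrite /D2/= in_itv/= andbT.
rewrite upper_gamma1 -(fineK Afin) -!EFinM -EFinD lte_fin AE mulrDr ltrD2l.
rewrite ltr_pM2r ?expR_gt0//.
by rewrite gt0_ltr_powR ?subr_gt0 ?nnegrE// ?addr_ge0// ltrDl.
Qed.

Lemma Gamma_gt0 a : 1 < a -> 0 < Gamma a.
Proof.
move=> a1; rewrite upper_gamma0E -lte_fin fineK ?upper_gamma0_fin// 1?ltW//.
apply: le_lt_trans (upper_gamma_gt a1 (lexx 0)).
by rewrite lee_fin mulr_ge0 ?powR_ge0 ?expR_ge0.
Qed.

End UpperGamma.
(** * Positivity of the Mittag-Leffler function of order 1/2 *)

Section MittagLeffler.
Context {R : realType}.
Implicit Types (a s x T : R) (n m k : nat).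

(** The regularized upper incomplete gamma function: the tail beyond [T] of the
    gamma distribution of parameter [a]. *)
Definition gammaQ a T : R := fine (upper_gamma a T) / Gamma a.

Lemma gammaQ_le1 a T : 1 < a -> 0 <= T -> gammaQ a T <= 1.
Proof.
move=> a1 T0; have a1' := ltW a1.
rewrite /gammaQ ler_pdivrMr ?Gamma_gt0// mul1r upper_gamma0E.
by rewrite fine_le ?upper_gamma_fin ?upper_gamma0_fin// upper_gamma_le0.
Qed.

Lemma gammaQS a T : 1 < a -> 0 <= T ->
  gammaQ (a + 1) T = gammaQ a T + T `^ a * expR (- T) / Gamma (a + 1).
Proof.
move=> a1 T0; have a1' := ltW a1.
have a0 : a != 0 by rewrite gt_eqF// (lt_trans ltr01).
have G0 : Gamma a != 0 by rewrite gt_eqF// Gamma_gt0.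
rewrite /gammaQ upper_gammaS// GammaS// -(fineK (upper_gamma_fin a1' T0)).
rewrite -EFinM -EFinD /=.
by field; rewrite a0 G0.
Qed.

Lemma gammaQ_gt a T : 1 < a -> 0 <= T ->
  T `^ (a - 1) * expR (- T) / Gamma a < gammaQ a T.
Proof.
move=> a1 T0; rewrite ltr_pM2r ?invr_gt0 ?Gamma_gt0//.
by rewrite -lte_fin fineK ?upper_gamma_fin// ?ltW// upper_gamma_gt.
Qed.

Definition ml_coeff x k : R := x ^+ k / Gamma (2^-1 * k%:R + 1).

Lemma ml_coeff_ge0 x k : 0 <= x -> 0 <= ml_coeff x k.
Proof.
move=> x0; rewrite mulr_ge0 ?exprn_ge0// invr_ge0.
have [->|k0] := posnP k.
  by rewrite mulr0 add0r -[1]/(1%:R) Gamma_fact.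
by rewrite ltW// Gamma_gt0// ltrDr mulr_gt0 ?invr_gt0 ?ltr0n.
Qed.

Lemma ml_coeff_even x m : ml_coeff x m.*2 = exp_coeff (x ^+ 2) m.
Proof.
rewrite /ml_coeff /exp_coeff/= -muln2 mulnC exprM natrM mulKf ?pnatr_eq0//.
by rewrite natr1 Gamma_fact.
Qed.

(** Every step from [a] to [a + 1] increases [gammaQ a T] by
    [T^a e^-T / Gamma (a + 1)].  For [a = m + 3/2] and [T = x^2] this is
    [e^-T] times the odd term of index [2 m + 3], so the sum of these terms
    telescopes between [gammaQ (3/2) T] and a value at most [1].  Starting at
    [3/2] instead of [1/2] avoids the singular density of [Gamma (1/2)], at the
    price of a separate treatment of the term of index [1]. *)
Lemma ml_coeff_odd_sum_le x n : 0 <= x ->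
  expR (- x ^+ 2) * (\sum_(0 <= m < n) ml_coeff x m.*2.+1) <=
  1 - (gammaQ (2^-1 + 1) (x ^+ 2) - expR (- x ^+ 2) * ml_coeff x 1).
Proof.
move=> x0; set T := x ^+ 2.
have T0 : 0 <= T by exact: exprn_ge0.
have h1 : (1 : R) < 2^-1 + 1 by rewrite ltrDr.
have hm m : (1 : R) < m%:R + (2^-1 + 1).
  by rewrite (lt_le_trans h1)// lerDr.
have dbl m : m.*2.+1%:R = m%:R * 2 + 1 :> R by rewrite -natr1 -muln2 natrM.
have Tpow m : T `^ (m%:R + 2^-1) = x ^+ m.*2.+1.
  rewrite /T -(powR_mulrn 2 x0) -powRrM -(powR_mulrn _ x0); congr (_ `^ _).
  by rewrite dbl; field.
clearbody T.
have step n' : expR (- T) * (\sum_(0 <= m < n'.+1) ml_coeff x m.*2.+1) =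
    expR (- T) * ml_coeff x 1 +
    (gammaQ (n'%:R + (2^-1 + 1)) T - gammaQ (2^-1 + 1) T).
  elim: n' => [|n' IH]; first by rewrite big_nat1 add0r subrr addr0.
  rewrite big_nat_recr; last by [].
  rewrite mulrDr IH.
  have -> : n'.+1%:R + (2^-1 + 1) = n'%:R + (2^-1 + 1) + 1 :> R.
    by rewrite -natr1; ring.
  rewrite (gammaQS (hm n') T0).
  have -> : n'%:R + (2^-1 + 1) = n'.+1%:R + 2^-1 :> R by rewrite -natr1; ring.
  rewrite Tpow /ml_coeff.
  have -> : 2^-1 * n'.+1.*2.+1%:R + 1 = n'.+1%:R + 2^-1 + 1 :> R.
    by rewrite dbl; field.
  move: (gammaQ _ _) (gammaQ _ _) (Gamma _)^-1 (expR _) (x ^+ n'.+1.*2.+1) (x ^+ 1 / _).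
  by move=> q q' g e y c; ring.
case: n => [|n].
  rewrite big_geq// mulr0 subr_ge0 lerBlDr.
  rewrite (le_trans (gammaQ_le1 h1 T0))// lerDl mulr_ge0 ?expR_ge0//.
  exact: ml_coeff_ge0.
rewrite step; have := gammaQ_le1 (hm n) T0.
by move: (gammaQ _ _) (gammaQ _ _) (_ * _) => q q' c; lra.
Qed.

Lemma mittag_leffler_partial x n :
  series (fun k => (- x) ^+ k / Gamma (2^-1 * k%:R + 1)) n =
  series (exp_coeff (x ^+ 2)) (uphalf n) -
  \sum_(0 <= m < n./2) ml_coeff x m.*2.+1.
Proof.
have E k : (- x) ^+ k / Gamma (2^-1 * k%:R + 1) = (-1) ^+ k * ml_coeff x k.
  by rewrite [(- x) ^+ k]exprNn -mulrA.
rewrite /series/=; elim: n => [|n IH]; first by rewrite !big_geq// subrr.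
rewrite big_nat_recr//= IH E; move: (odd_double_half n); rewrite uphalf_half.
have := signr_odd R n; case: (odd n) => /= <- nE.
  rewrite add1n [X in _ = _ - X]big_nat_recr//= expr1 mulN1r opprD addrA.
  by rewrite add1n in nE; rewrite nE.
rewrite !add0n in nE *; rewrite [in RHS]big_nat_recr//= expr0 mul1r.
by rewrite -ml_coeff_even nE addrAC.
Qed.

Lemma cvg_half : n./2 @[n --> \oo] --> \oo.
Proof.
move=> A [N _ NA]; exists N.*2 => // n /= Nn; apply: NA => /=.
by rewrite -(doubleK N) half_leq.
Qed.

Lemma cvg_uphalf : uphalf n @[n --> \oo] --> \oo.
Proof.
move=> A [N _ NA]; exists N.*2 => // n /= Nn; apply: NA => /=.
by move: (half_leq Nn); rewrite doubleK uphalf_half => /leq_trans -> //; exact: leq_addl.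
Qed.

(** The odd terms add up to at most [e^T (1 - d)], where the excess [d] of
    [gammaQ (3/2) T] over [e^-T] times the first odd term is positive by
    [gammaQ_gt]; the even terms add up to [e^T]. *)
Lemma mittag_leffler_gt0 x : 0 <= x -> 0 < mittag_leffler 2^-1 (- x).
Proof.
move=> x0; set T := x ^+ 2.
have T0 : 0 <= T by exact: exprn_ge0.
have h1 : (1 : R) < 2^-1 + 1 by rewrite ltrDr.
pose d := gammaQ (2^-1 + 1) T - expR (- T) * ml_coeff x 1.
have d0 : 0 < d.
  rewrite subr_gt0 (le_lt_trans _ (gammaQ_gt h1 T0))// addrK.
  rewrite powR12_sqrt// sqrtr_sqr ger0_norm// /ml_coeff mulr1 expr1 mulrA.
  by rewrite [expR _ * _]mulrC.
pose O := fun n => \sum_(0 <= m < n) ml_coeff x m.*2.+1.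
have Ob n : O n <= expR T * (1 - d).
  have := ml_coeff_odd_sum_le n x0; rewrite -/T -/d expRN.
  by rewrite ler_pdivrMl ?expR_gt0.
have ndO : nondecreasing_seq O.
  apply/nondecreasing_seqP => n; rewrite /O big_nat_recr//= lerDl.
  exact: ml_coeff_ge0.
have cO : cvgn O.
  apply: nondecreasing_is_cvgn => //.
  by exists (expR T * (1 - d)) => _ [n _ <-].
have lO : limn O <= expR T * (1 - d).
  by apply: limr_le => //; apply: nearW.
apply: (@lt_le_trans _ _ (expR T * d)); first by rewrite mulr_gt0 ?expR_gt0.
have cE : series (exp_coeff T) n @[n --> \oo] --> expR T.
  exact: is_cvg_series_exp_coeff.
suff: series (fun k => (- x) ^+ k / Gamma (2^-1 * k%:R + 1)) n @[n --> \oo]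
    --> expR T - limn O.
  move=> /cvg_lim; rewrite /mittag_leffler => -> //.
  by rewrite lerBrDr -lerBrDl; move: lO; rewrite mulrBr mulr1.
rewrite (funext (mittag_leffler_partial x)).
apply: cvgB; last by apply: (cvg_comp _ _ cvg_half cO).
apply: (cvg_comp uphalf (series (exp_coeff T)) _ cE).
exact: cvg_uphalf.
Qed.

End MittagLeffler.
(** * Smooth functions of one variable *)

Section Smooth1.
Context {R : realType}.
Implicit Types (f g : R -> R) (a b c s x : R) (n k : nat).

Fixpoint derivable_times n f : Prop :=
  if n is n'.+1 then (forall x, derivable f x 1) /\ derivable_times n' (derive1 f)
  else True.

Definition smooth1 f : Prop := forall n, derivable_times n f.

Lemma derivable_timesW n f : derivable_times n.+1 f -> derivable_times n f.
Proof. by elim: n f => [//|n IH] f [df d2f]; split => //; exact: IH. Qed.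

Lemma derivable_timesD n f g : derivable_times n f -> derivable_times n g ->
  derivable_times n (f \+ g).
Proof.
elim: n f g => [//|n IH] f g [df d2f] [dg d2g]; split.
  by move=> x; exact: derivableD.
rewrite (_ : derive1 (f \+ g) = derive1 f \+ derive1 g); first exact: IH.
by apply/funext => x /=; rewrite !derive1E deriveD.
Qed.

Lemma derivable_timesZ n c f : derivable_times n f ->
  derivable_times n (fun x => c * f x).
Proof.
elim: n f => [//|n IH] f [df d2f]; split.
  by move=> x; exact: derivableZ.
rewrite (_ : derive1 (fun x => c * f x) = (fun x => c * derive1 f x)); first exact: IH.
by apply/funext => x /=; rewrite !derive1E (deriveZ _ (df x)).
Qed.

Lemma derivable_timesM n f g : derivable_times n f -> derivable_times n g ->
  derivable_times n (f \* g).
Proof.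
elim: n f g => [//|n IH] f g nf ng.
have [[df d2f] [dg d2g]] := (nf, ng); split.
  by move=> x; exact: derivableM.
rewrite (_ : derive1 (f \* g) = (f \* derive1 g) \+ (g \* derive1 f)).
  by apply: derivable_timesD; apply: IH => //; exact: derivable_timesW.
by apply/funext => x /=; rewrite !derive1E (deriveM (df x) (dg x)).
Qed.

Lemma is_derive_affine f a b x : derivable f (a * x + b) 1 ->
  is_derive x 1 (fun s => f (a * s + b)) (a * derive1 f (a * x + b)).
Proof.
move=> df; have daff : is_derive x 1 (fun s : R => a * s + b) a.
  by apply: is_derive_eq; rewrite addr0 /GRing.scale/= mulr1.
rewrite mulrC; apply: (@is_derive1_comp _ f (fun s => a * s + b)) => //.
by rewrite derive1E; exact: derivableP.
Qed.

Lemma derivable_times_affine n f a b : derivable_times n f ->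
  derivable_times n (fun s => f (a * s + b)).
Proof.
elim: n f => [//|n IH] f [df d2f]; split.
  by move=> x; have dx := @ex_derive _ _ _ _ _ _ _ (is_derive_affine (df (a * x + b))); exact dx.
rewrite (_ : derive1 _ = fun s => a * derive1 f (a * s + b)).
  by apply: derivable_timesZ; exact: IH.
apply/funext => x; rewrite derive1E.
by rewrite (@derive_val _ _ _ _ _ _ _ (is_derive_affine (df (a * x + b)))).
Qed.

Lemma derivable_times_sin_cos n : derivable_times n (@sin R) /\ derivable_times n (@cos R).
Proof.
elim: n => [//|n [IHs IHc]]; split; split.
- by move=> x; exact: derivable_sin.
- rewrite (_ : derive1 sin = cos)//; apply/funext => x.
  by rewrite derive1E derive_val.
- by move=> x; exact: derivable_cos.
- rewrite (_ : derive1 cos = fun x => (-1) * sin x); first exact: derivable_timesZ.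
  by apply/funext => x; rewrite derive1E derive_val mulN1r.
Qed.

(** The standard flat function [e^(-1/x)] is [flat 0]; the factors [x^-k] make
    the family stable under differentiation up to linear combinations, which
    is how all its derivatives are obtained at once. *)
Definition flat k x : R := if 0 < x then x^-1 ^+ k * expR (- x^-1) else 0.

Lemma flat_ge0 k x : 0 <= flat k x.
Proof.
by rewrite /flat; case: ifPn => // x0; rewrite mulr_ge0 ?expR_ge0// exprn_ge0// invr_ge0 ltW.
Qed.

Lemma flat_le k x : flat k x <= k.+1`!%:R * `|x|.
Proof.
rewrite /flat; case: ifPn => [x0|_]; last by rewrite mulr_ge0.
have y0 : 0 < x^-1 by rewrite invr_gt0.
rewrite gtr0_norm// expRN ler_pdivrMr ?expR_gt0// mulrAC -ler_pdivrMr// -exprSr.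
rewrite mulrC -ler_pdivrMr ?ltr0n ?fact_gt0//.
by rewrite (le_trans _ (expR_ge1Dxn k (ltW y0)))// lerDr.
Qed.

Lemma flat0_le1 x : flat 0 x <= 1.
Proof.
rewrite /flat; case: ifPn => // x0.
by rewrite expr0 mul1r -expR0 ler_expR oppr_le0 invr_ge0 ltW.
Qed.

Lemma cvg_flat0 : flat 0 x @[x --> +oo] --> (1 : R).
Proof.
apply: (@cvg_trans _ (expR (- x^-1) @[x --> +oo])).
  apply: near_eq_cvg; near=> x; rewrite /flat.
  have -> : 0 < x by near: x; exact: nbhs_pinfty_gt.
  by rewrite expr0 mul1r.
have cV : (fun x : R => - x^-1) @ +oo --> (- 0 : R).
  by apply: cvgN; apply/gtr0_cvgV0 => //; near=> x; near: x; exact: nbhs_pinfty_gt.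
have := cvg_comp _ _ cV (@continuous_expR R (- 0)).
by rewrite oppr0 expR0.
Unshelve. all: by end_near. Qed.

(** At the origin the difference quotient of [flat k] is [flat k.+1], which is
    bounded by a multiple of [|x|]. *)
Lemma is_derive_flat k x :
  is_derive x 1 (flat k) (flat k.+2 x - k%:R * flat k.+1 x).
Proof.
have [x0|x0|<-] := ltgtP 0 x.
- rewrite /flat x0.
  apply: (@near_eq_is_derive _ _ _ (fun x => x^-1 ^+ k * expR (- x^-1))).
    + by near=> z; rewrite ifT//; near: z; exact: lt_nbhsr.
  have dV : is_derive x 1 (fun s : R => s^-1) (- x ^- 2).
    by apply: is_derive_eq (is_deriveV (lt0r_neq0 x0) (is_derive_id x 1)) _; rewrite /GRing.scale/= mulr1.
  have dE : is_derive x 1 (fun s : R => expR (- s^-1)) (x ^- 2 * expR (- x^-1)).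
    rewrite mulrC; apply: (@is_derive1_comp _ expR (fun s => - s^-1)).
    by apply: is_derive_eq (is_deriveN dV) (opprK _).
  have dX : is_derive x 1 (fun s : R => s^-1 ^+ k) (- (k%:R * x^-1 ^+ k.+1)).
    have -> : (fun s : R => s^-1 ^+ k) = (fun s : R => s^-1) ^+ k.
      by rewrite exprfctE.
    apply: is_derive_eq.
    case: k => [|k]; first by rewrite !mul0r scale0r oppr0.
    by rewrite /GRing.scale/= mulrN -mulrA -exprVn -exprD addn2.
  apply: (is_derive_eq (is_deriveM dX dE)).
  rewrite /GRing.scale/= -exprVn; move: (x^-1) (expR _) => y e.
  by rewrite !exprS; ring.
- rewrite /flat (lt_gtF x0) mulr0 subrr.
  apply: (@near_eq_is_derive _ _ _ (cst 0)).
    + by near=> z; rewrite ifF//; apply/negbTE; rewrite -leNgt ltW//; near: z; exact: lt_nbhsl.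
- rewrite ![flat _ 0]/flat ltxx mulr0 subrr.
  have cv0 : (fun h : R => h^-1 *: ((flat k \o shift 0) (h *: (1 : R)) - flat k 0))
      @ 0^' --> (0 : R).
    have -> : (fun h : R => h^-1 *: ((flat k \o shift 0) (h *: (1 : R)) - flat k 0)) = flat k.+1.
      apply/funext => h /=; rewrite [flat _ 0]/flat ltxx subr0 addr0.
      rewrite /GRing.scale/= mulr1 /flat; case: ifP => _; last by rewrite mulr0.
      by rewrite mulrA -exprS.
    apply: norm_cvg0; apply: (@squeeze_cvgr _ _ _ _ (cst 0) (fun x => k.+2`!%:R * `|x|)).
    - by near=> z; rewrite normr_ge0/= ger0_norm ?flat_ge0// flat_le.
    - exact: cvg_cst.
    - suff : (fun x : R => k.+2`!%:R * `|x|) @ 0^' --> k.+2`!%:R * `|(0 : R)|.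
        by rewrite normr0 mulr0.
      apply: cvg_within_filter; apply: cvgM; first exact: cvg_cst.
      exact: norm_continuous.
  split; first by apply/cvg_ex; exists 0.
  exact: cvg_lim cv0.
Unshelve. all: by end_near. Qed.

Lemma derivable_times_flat n k : derivable_times n (flat k).
Proof.
elim: n k => [//|n IH] k; split.
  by move=> x; have dx := @ex_derive _ _ _ _ _ _ _ (is_derive_flat k x); exact dx.
rewrite (_ : derive1 (flat k) = flat k.+2 \+ (fun x => (- k%:R) * flat k.+1 x)).
  by apply: derivable_timesD => //; exact: derivable_timesZ.
apply/funext => x; rewrite derive1E.
by rewrite (@derive_val _ _ _ _ _ _ _ (is_derive_flat k x)) /= mulNr.
Qed.

End Smooth1.
(** * Integration on rectangles of the plane *)

Section Plane.
Context {R : realType}.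
Implicit Types (f g u : R * R -> R) (a b c d : R).
Local Notation mu := (@lebesgue_measure R).
Local Notation leb2 := (mu \x mu)%E.
Local Notation Rm := (g_sigma_algebraType (R.-ocitv.-measurable)).
Local Notation plane := (Rm * Rm)%type.
Local Notation meas2 A := (@measurable _ plane A).
Local Notation measf2 f := (@measurable_fun _ _ plane R setT f).

Definition rat_rectangle (q : (rat * rat) * (rat * rat)) : set (R * R) :=
  `]ratr q.1.1, ratr q.1.2[%classic `*` `]ratr q.2.1, ratr q.2.2[%classic.

Lemma measurable_rectangle a b c d :
  meas2 (`]a, b[%classic `*` `]c, d[%classic).
Proof. by apply: measurableX; exact: measurable_itv. Qed.

(** An open set of the plane is a countable union of rectangles with rational
    vertices.  The sigma-algebra here is the product of the Borel
    sigma-algebras generated by half-open intervals, which carries the product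
    of the Lebesgue measures. *)
Lemma open_measurable2 (U : set (R * R)) : open U -> meas2 U.
Proof.
move=> oU.
pose F n : set (R * R) := if unpickle n is Some q
  then [set z | rat_rectangle q z /\ rat_rectangle q `<=` U] else set0.
suff -> : U = \bigcup_n F n.
  apply: bigcupT_measurable => n; rewrite /F; case: unpickle => [q|//].
  have [qU|qU] := pselect (rat_rectangle q `<=` U).
    rewrite (_ : [set _ | _] = rat_rectangle q); first exact: measurable_rectangle.
    by apply/seteqP; split => z //= -[].
  rewrite (_ : [set _ | _] = set0) ?measurable0//.
  by apply/seteqP; split => z //= -[].
apply/seteqP; split => [z Uz|z [n _]]; last first.
  by rewrite /F; case: unpickle => //= q [zq]; exact.
have /nbhs_ballP[e /= e0 zU] : nbhs z U by exact: open_nbhs_nbhs.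
have near_rat (s : R) : exists2 q : rat * rat, s \in `]ratr q.1, ratr q.2[ &
    forall t, t \in `]ratr q.1, ratr q.2[ -> `|s - t| < e.
  have /rat_in_itvoo[p1 pp1] : s - e < s by rewrite ltrBlDr ltrDl.
  have /rat_in_itvoo[p2 pp2] : s < s + e by rewrite ltrDl.
  move: pp1 pp2; rewrite !in_itv/= => /andP[? ?] /andP[? ?].
  exists (p1, p2); first by rewrite in_itv/=; apply/andP.
  move=> t; rewrite in_itv/= => /andP[? ?].
  by rewrite ltr_norml; apply/andP; split; lra.
have [q1 zq1 q1e] := near_rat z.1; have [q2 zq2 q2e] := near_rat z.2.
exists (pickle (q1, q2)); first exact: I.
rewrite /F pickleK; split; first by split.
by move=> t [t1 t2]; apply: zU; split; [exact: q1e|exact: q2e].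
Qed.

Lemma continuous_measurable2 f : continuous f -> measf2 f.
Proof.
move=> /continuousP cf; apply: (measurability _ (RGenOpens.measurableE R)) => //.
move=> _ [_ [a [b ->] <-]]; rewrite setTI.
by apply: open_measurable2; apply: cf; exact: interval_open.
Qed.

(** Both [Omega] and [omega] are of this form, which is the reason for fixing
    the first side. *)
Definition rect c d : set (R * R) :=
  `]0, 1[%classic `*` `]c, d[%classic.

Lemma measurable_rect c d : meas2 (rect c d).
Proof. exact: measurable_rectangle. Qed.

Lemma rect_lty c d : (leb2 (rect c d) < +oo)%E.
Proof.
rewrite product_measure1E; [|exact: measurable_itv|exact: measurable_itv].
rewrite /= !lebesgue_measure_itv/= lte_fin ltr01 lte_fin.
by case: ifP => _; rewrite ?mule0// -!EFinB -EFinM ltry.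
Qed.

Lemma rect_sub_Omega c d : 0 <= c -> d <= 1 -> rect c d `<=` @Omega R.
Proof.
move=> c0 d1 [x y] /= [? /=]; rewrite in_itv/= => /andP[cy yd]; split => //=.
by rewrite in_itv/= (le_lt_trans c0)//= (lt_le_trans yd).
Qed.

Lemma continuous_bounded_rect f c d : continuous f ->
  exists2 M, 0 < M & forall z, rect c d z -> `|f z| <= M.
Proof.
move=> cf.
have : compact (f @` (`[0, 1]%classic `*` `[c, d]%classic)).
  apply: continuous_compact; first exact: continuous_subspaceT.
  by apply: compact_setX; exact: segment_compact.
move=> /compact_bounded[M [_ HM]].
exists (`|M| + 1); first by rewrite ltr_wpDl.
move=> z [z1 z2]; apply: (HM (`|M| + 1)).
  by rewrite (le_lt_trans (ler_norm _))// ltrDl.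
by exists z => //; split; apply: subset_itv_oo_cc.
Qed.

Lemma integrable_rect f c d : measf2 f ->
  (exists M, forall z, rect c d z -> `|f z| <= M) ->
  leb2.-integrable (rect c d) (EFin \o f).
Proof.
move=> mf [M fM]; apply: measurable_bounded_integrable => //.
- exact: measurable_rect.
- exact: rect_lty.
- exact: measurable_funTS.
- exists M; split; first exact: num_real.
  by move=> N MN z zr; exact: (le_trans (fM z zr) (ltW MN)).
Qed.

Lemma continuous_integrable_rect f c d : continuous f ->
  leb2.-integrable (rect c d) (EFin \o f).
Proof.
move=> cf; apply: integrable_rect; first exact: continuous_measurable2.
by have [M _ fM] := continuous_bounded_rect c d cf; exists M.
Qed.

Lemma Rintegral_rect12 f c d : leb2.-integrable (rect c d) (EFin \o f) ->
  \int[leb2]_(z in rect c d) f z =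
  fine (\int[mu]_(x in `]0%R, 1%R[) \int[mu]_(y in `]c, d[) (f (x, y))%:E)%E.
Proof.
move=> fi; rewrite /Rintegral integral_mkcond -integral12_prod_meas1; last first.
  exact: ((@integrable_mkcond _ plane _ leb2 _ (EFin \o f) (measurable_rect c d)).1 fi).
congr fine; rewrite [RHS]integral_mkcond; apply: eq_integral => x _.
rewrite /fubini_F patchE; case: ifPn => x01.
  rewrite [RHS]integral_mkcond; apply: eq_integral => y _; rewrite !patchE.
  by rewrite /rect in_setX x01.
rewrite integral0_eq// => y _; rewrite patchE /rect in_setX (negbTE x01).
by [].
Qed.

Lemma Rintegral_rect21 f c d : leb2.-integrable (rect c d) (EFin \o f) ->
  \int[leb2]_(z in rect c d) f z =
  fine (\int[mu]_(y in `]c, d[) \int[mu]_(x in `]0%R, 1%R[) (f (x, y))%:E)%E.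
Proof.
move=> fi; rewrite /Rintegral integral_mkcond -integral21_prod_meas1; last first.
  exact: ((@integrable_mkcond _ plane _ leb2 _ (EFin \o f) (measurable_rect c d)).1 fi).
congr fine; rewrite [RHS]integral_mkcond; apply: eq_integral => y _.
rewrite /fubini_G patchE; case: ifPn => x01.
  rewrite [RHS]integral_mkcond; apply: eq_integral => x _; rewrite !patchE.
  by rewrite /rect in_setX x01 andbT.
rewrite integral0_eq// => x _; rewrite patchE /rect in_setX (negbTE x01) andbF.
by [].
Qed.

Lemma dir1_quotient f a b :
  (fun h : R => h^-1 *: ((f \o shift (a, b)) (h *: @dir1 R) - f (a, b))) =
  (fun h : R => h^-1 *: (((fun s => f (s, b)) \o shift a) (h *: (1 : R)) - f (a, b))).
Proof.
apply/funext => h /=; congr (_ *: (f _ - _)).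
by rewrite /dir1 /GRing.add /GRing.scale/= /add_pair /scale_pair/= scaler0 add0r.
Qed.

Lemma dir2_quotient f a b :
  (fun h : R => h^-1 *: ((f \o shift (a, b)) (h *: @dir2 R) - f (a, b))) =
  (fun h : R => h^-1 *: (((fun s => f (a, s)) \o shift b) (h *: (1 : R)) - f (a, b))).
Proof.
apply/funext => h /=; congr (_ *: (f _ - _)).
by rewrite /dir2 /GRing.add /GRing.scale/= /add_pair /scale_pair/= scaler0 add0r.
Qed.

Lemma partial1E f a b : partial1 f (a, b) = derive1 (fun s => f (s, b)) a.
Proof. by rewrite derive1E /partial1 /derive dir1_quotient. Qed.

Lemma partial2E f a b : partial2 f (a, b) = derive1 (fun s => f (a, s)) b.
Proof. by rewrite derive1E /partial2 /derive dir2_quotient. Qed.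

Lemma derivable_dir1 f a b :
  derivable f (a, b) (dir1 R) <-> derivable (fun s => f (s, b)) a 1.
Proof. by rewrite /derivable dir1_quotient. Qed.

Lemma derivable_dir2 f a b :
  derivable f (a, b) (dir2 R) <-> derivable (fun s => f (a, s)) b 1.
Proof. by rewrite /derivable dir2_quotient. Qed.

End Plane.
(** * Integration by parts on rectangles *)

Section Calculus.
Context {R : realType}.
Implicit Types (f g u p : R * R -> R) (F G : R -> R) (a b c d : R).
Local Notation mu := (@lebesgue_measure R).
Local Notation leb2 := (mu \x mu)%E.
Local Notation Rm := (g_sigma_algebraType (R.-ocitv.-measurable)).
Local Notation plane := (Rm * Rm)%type.

Lemma integral_oo_FTC G F a b : a < b -> continuous G ->
  (forall x : R, is_derive x 1 F (G x)) ->
  (\int[mu]_(x in `]a, b[) (G x)%:E)%E = (F b - F a)%:E.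
Proof.
move=> ab cG dF.
have cF : continuous F.
  move=> x; apply: differentiable_continuous; apply/derivable1_diffP.
  have dx := @ex_derive _ _ _ _ _ _ _ (dF x); exact dx.
rewrite -(@integral_itv_bndoo _ a b _ true false); last first.
  by apply/measurable_EFinP; apply: measurable_funTS; exact: continuous_measurable_fun.
rewrite (@continuous_FTC2 _ G F)//.
- exact: continuous_subspaceT.
- split; last 2 first.
  + by apply: cvg_at_right_filter; exact: cF.
  + by apply: cvg_at_left_filter; exact: cF.
  by move=> x _; have dx := @ex_derive _ _ _ _ _ _ _ (dF x); exact dx.
- move=> x _; rewrite derive1E.
  by rewrite (@derive_val _ _ _ _ _ _ _ (dF x)).
Qed.

Lemma continuous_hsection f b : continuous f -> continuous (fun s => f (s, b)).
Proof.
move=> cf s; apply: (@continuous_comp _ _ _ (fun s => (s, b)) f); last exact: cf.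
by apply: (@cvg_pair _ _ _ (nbhs s) (nbhs s) (nbhs b)); [exact: cvg_id|exact: cvg_cst].
Qed.

Lemma continuous_vsection f a : continuous f -> continuous (fun s => f (a, s)).
Proof.
move=> cf s; apply: (@continuous_comp _ _ _ (fun s => (a, s)) f); last exact: cf.
by apply: (@cvg_pair _ _ _ (nbhs s) (nbhs a) (nbhs s)); [exact: cvg_cst|exact: cvg_id].
Qed.

Definition dir (e : bool) : R * R := if e then dir1 R else dir2 R.
Definition partial (e : bool) f := if e then partial1 f else partial2 f.

(** Regularity in the direction [e] only: each component of a vector field is
    differentiated in a single direction by the divergence. *)
Definition C1 e f : Prop := [/\ continuous f,
  forall x, derivable f x (dir e) & continuous (partial e f)].

(** The two sides of [rect c d] orthogonal to the direction [e]. *)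
Definition vanishes_on_sides e c d f : Prop :=
  if e then forall y, c < y < d -> f (0, y) = 0 /\ f (1, y) = 0
  else forall x, 0 < x < 1 -> f (x, c) = 0 /\ f (x, d) = 0.

(** By Fubini, integrating first in the direction [e], where the fundamental
    theorem of calculus leaves the values on the two sides. *)
Lemma Rintegral_partial_eq0 e f c d : c < d -> C1 e f ->
  vanishes_on_sides e c d f ->
  \int[leb2]_(z in rect c d) partial e f z = 0.
Proof.
move=> cd [cf df cdf] f0.
have fi := continuous_integrable_rect c d cdf.
case: e df cdf f0 fi => /= df cdf f0 fi.
- rewrite Rintegral_rect21// integral0_eq// => y; rewrite /= in_itv/= => ycd.
  have dy (x : R) : is_derive x 1 (fun s => f (s, y)) (partial1 f (x, y)).
    rewrite partial1E derive1E; apply: derivableP.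
    by apply/derivable_dir1; exact: df.
  rewrite (integral_oo_FTC ltr01 (continuous_hsection cdf) dy).
  by have [-> ->] := f0 _ ycd; rewrite subrr.
- rewrite Rintegral_rect12// integral0_eq// => x; rewrite /= in_itv/= => x01.
  have dx (y : R) : is_derive y 1 (fun s => f (x, s)) (partial2 f (x, y)).
    rewrite partial2E derive1E; apply: derivableP.
    by apply/derivable_dir2; exact: df.
  rewrite (integral_oo_FTC cd (continuous_vsection cdf) dx).
  by have [-> ->] := f0 _ x01; rewrite subrr.
Qed.

Lemma partialE e f : partial e f = (fun x => 'D_(dir e) f x).
Proof. by case: e. Qed.

Lemma partialM e f g x : derivable f x (dir e) -> derivable g x (dir e) ->
  partial e (f \* g) x = f x * partial e g x + g x * partial e f x.
Proof. by move=> df dg; rewrite !partialE (deriveM df dg). Qed.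

Lemma continuousM2 f g : continuous f -> continuous g -> continuous (f \* g).
Proof. by move=> cf cg x; apply: cvgM; [exact: cf|exact: cg]. Qed.

Lemma C1M e f g : C1 e f -> C1 e g -> C1 e (f \* g).
Proof.
move=> [cf df cdf] [cg dg cdg]; split; first exact: continuousM2.
  by move=> x; exact: derivableM.
rewrite (_ : partial e (f \* g) =
    (fun x => f x * partial e g x + g x * partial e f x)).
  by move=> x; apply: cvgD; apply: cvgM; [exact: cf|exact: cdg|exact: cg|exact: cdf].
by apply/funext => x; exact: partialM.
Qed.

Lemma integration_by_parts_rect e f g c d : c < d -> C1 e f -> C1 e g ->
  vanishes_on_sides e c d (f \* g) ->
  \int[leb2]_(z in rect c d) (f z * partial e g z) =
  - \int[leb2]_(z in rect c d) (partial e f z * g z).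
Proof.
move=> cd Cf Cg fg0.
have [[cf df cdf] [cg dg cdg]] := (Cf, Cg).
have := Rintegral_partial_eq0 cd (C1M Cf Cg) fg0.
rewrite (_ : partial e (f \* g) =
    (fun x => f x * partial e g x + partial e f x * g x)); last first.
  by apply/funext => x; rewrite partialM// [g x * _]mulrC.
rewrite (@RintegralD _ plane _ leb2)//; last 3 first.
- exact: measurable_rect.
- exact/continuous_integrable_rect/(continuousM2 cf cdg).
- exact/continuous_integrable_rect/(continuousM2 cdf cg).
by move/eqP; rewrite addr_eq0 => /eqP.
Qed.

End Calculus.
(** * The space L^2 of the unit square *)

Section L2.
Context {R : realType}.
Implicit Types (f g u p : R * R -> R) (a b c d : R).
Local Notation mu := (@lebesgue_measure R).
Local Notation leb2 := (mu \x mu)%E.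
Local Notation Rm := (g_sigma_algebraType (R.-ocitv.-measurable)).
Local Notation plane := (Rm * Rm)%type.
Local Notation meas2 A := (@measurable _ plane A).
Local Notation measf2 f := (@measurable_fun _ _ plane R setT f).

Lemma measurable_Omega : meas2 (@Omega R).
Proof. exact: measurable_rect. Qed.

Lemma in_E_measurable f : in_E f -> measf2 (f \_ (@Omega R)).
Proof. by rewrite /in_E inE => /andP[/[!inE]]. Qed.

Lemma in_E_lty f : in_E f -> ('N[leb2]_2%:E[EFin \o (f \_ (@Omega R))] < +oo)%E.
Proof. by rewrite /in_E inE => /andP[_ /[!inE]]. Qed.

Lemma bounded_in_E f : measf2 f ->
  (exists M, forall z, @Omega R z -> `|f z| <= M) -> in_E f.
Proof.
move=> mf [M fM].
have mfO : measf2 (f \_ (@Omega R)).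
  apply: (measurable_restrictT _ measurable_Omega).1; exact: (@measurable_funTS _ _ plane R).
rewrite /in_E inE; apply/andP; split; rewrite inE//= /finite_norm.
apply: (@lty_poweRy _ _ 2) => //; rewrite powR_Lnorm//.
have /integrableP[_] : leb2.-integrable (rect 0 1) (EFin \o (fun z => f z ^+ 2)).
  apply: integrable_rect; first exact: measurable_funX.
  exists (M ^+ 2) => z Oz; rewrite normrX lerXn2r ?nnegrE//.
    by rewrite (le_trans _ (fM _ Oz)).
  exact: fM.
apply: le_lt_trans; rewrite [leRHS]integral_mkcond le_eqVlt; apply/orP; left; apply/eqP.
apply: eq_integral => z _; rewrite /= !patchE; case: ifP => _ /=.
  by rewrite powR_mulrn// normrX.
by rewrite normr0 powR0.
Qed.

Lemma continuous_in_E f : continuous f -> in_E f.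
Proof.
move=> cf; apply: bounded_in_E; first exact: continuous_measurable2.
by have [M _ fM] := continuous_bounded_rect 0 1 cf; exists M.
Qed.

Lemma in_E_mulr_integrable f g : in_E f -> in_E g ->
  leb2.-integrable (@Omega R) (EFin \o (f \* g)).
Proof.
move=> Ef Eg; have := Lfun2_mul_Lfun1 Ef Eg => /Lfun1_integrable H.
apply: ((@integrable_mkcond _ plane _ leb2 _ (EFin \o (f \* g)) measurable_Omega).2 _).
rewrite (_ : _ \_ _ = EFin \o ((f \_ (@Omega R)) \* (g \_ (@Omega R))))//.
by apply/funext => z; rewrite /= !patchE; case: ifP; rewrite ?mulr0.
Qed.

Lemma innerEC f g : innerE f g = innerE g f.
Proof. by congr fine; apply: eq_integral => z _; rewrite mulrC. Qed.

Lemma eq_innerE f f' g g' : (forall z, @Omega R z -> f z = f' z) ->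
  (forall z, @Omega R z -> g z = g' z) -> innerE f g = innerE f' g'.
Proof.
move=> ff' gg'; congr fine; apply: eq_integral => z /set_mem Oz.
by rewrite ff'// gg'.
Qed.

(** Continuity of the inner product for the L^2-norm, that is, the
    Cauchy-Schwarz inequality; it transfers identities from test functions to
    [H_0^1]. *)
Lemma cvg_innerE (u : (R * R -> R)^nat) f p :
  (forall n, in_E (u n)) -> in_E f -> in_E p -> cvg_E u f ->
  innerE (u n) p @[n --> \oo] --> innerE f p.
Proof.
move=> Eu Ef Ep uf.
pose W n := ('N[leb2]_2%:E[EFin \o ((u n \- f)%R \_ (@Omega R))])%E.
pose M := fine ('N[leb2]_2%:E[EFin \o (p \_ (@Omega R))])%E.
have Mfin : ('N[leb2]_2%:E[EFin \o (p \_ (@Omega R))])%E \is a fin_num.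
  by rewrite ge0_fin_numE ?Lnorm_ge0// in_E_lty.
have CS n : (`|innerE f p - innerE (u n) p|%:E <= W n * M%:E)%E.
  have iu := in_E_mulr_integrable (Eu n) Ep.
  have iF := in_E_mulr_integrable Ef Ep.
  rewrite distrC /innerE -(@RintegralB _ plane _ leb2)//; last exact: measurable_Omega.
  have iB : leb2.-integrable (@Omega R) (EFin \o (fun z => u n z * p z - f z * p z)).
    rewrite (_ : _ \o _ = (EFin \o (u n \* p)%R) \- (EFin \o (f \* p)%R))%E//.
    exact: (@integrableB _ plane _ leb2 _ measurable_Omega _ _ iu iF).
  apply: (@le_trans _ _ (\int[leb2]_(z in @Omega R) `|u n z * p z - f z * p z|%:E)%E).
    rewrite (@EFin_normr_Rintegral _ plane _ leb2 _ _ measurable_Omega iB).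
    by apply: le_abse_integral; [exact: measurable_Omega|exact: measurable_int iB].
  have mB : measf2 ((u n \- f) \_ (@Omega R)).
    rewrite (_ : _ \_ _ = (u n \_ (@Omega R)) \- (f \_ (@Omega R))).
      by apply: measurable_funB; exact: in_E_measurable.
    by apply/funext => z; rewrite /= !patchE; case: ifP; rewrite ?subr0.
  have := @hoelder _ plane _ leb2 ((u n \- f) \_ (@Omega R)) (p \_ (@Omega R)) 2 2 mB (in_E_measurable Ep).
  rewrite -/(W n) -(fineK Mfin) -/M => H.
  apply: le_trans (H _ _ _) => //; last by rewrite [RHS]splitr !div1r.
  rewrite Lnorm1 [leLHS]integral_mkcond le_eqVlt; apply/orP; left; apply/eqP.
  apply: eq_integral => z _; rewrite /= !patchE; case: ifP => _ /=.
    by rewrite mulrBl.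
  by rewrite mulr0 normr0.
have /fine_cvgP[Wfin W0] : W n @[n --> \oo] --> (0 : R)%:E by exact: uf.
have M0 : 0 <= M by rewrite fine_ge0// Lnorm_ge0.
apply/cvgrPdist_le => e e0.
have WM : (fine \o W) n * M @[n --> \oo] --> 0 * M.
  by apply: cvgM; [exact: W0|exact: cvg_cst].
rewrite mul0r in WM; move/cvgrPdist_le : WM => /(_ e e0) WM.
near=> n.
have Wn : W n \is a fin_num by near: n.
rewrite -lee_fin (le_trans (CS n))// -(fineK Wn) -EFinM lee_fin.
have : `|0 - (fine \o W) n * M| <= e by near: n.
by rewrite sub0r normrN; exact: le_trans (ler_norm _).
Unshelve. all: by end_near. Qed.

End L2.
(** * Test functions and the adjoint of the gradient *)

Section TestFunctions.
Context {R : realType}.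
Implicit Types (f u w : R * R -> R) (a b : R -> R) (c d : R).
Local Notation mu := (@lebesgue_measure R).
Local Notation leb2 := (mu \x mu)%E.
Local Notation Rm := (g_sigma_algebraType (R.-ocitv.-measurable)).
Local Notation plane := (Rm * Rm)%type.

Lemma smooth1_derive a : smooth1 a -> smooth1 (derive1 a).
Proof. by move=> sa n; have [] := sa n.+1. Qed.

Lemma smooth1_derivable a x : smooth1 a -> derivable a x 1.
Proof. by move=> sa; have [+ _] := sa 1%N; exact. Qed.

Lemma smooth1_continuous a : smooth1 a -> continuous a.
Proof.
move=> sa x; apply: differentiable_continuous; apply/derivable1_diffP.
exact: smooth1_derivable.
Qed.

Lemma smooth1M a b : smooth1 a -> smooth1 b -> smooth1 (a \* b).
Proof. by move=> sa sb n; apply: derivable_timesM. Qed.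

(** Functions with separated variables: partial derivatives, hence smoothness,
    and integrals over rectangles reduce to one variable. *)
Definition tensor a b : R * R -> R := fun z => a z.1 * b z.2.

Lemma continuous_tensor a b : continuous a -> continuous b ->
  continuous (tensor a b).
Proof.
move=> ca cb [x y]; apply: cvgM.
  by apply: (@continuous_comp _ _ _ fst a); [exact: cvg_fst|exact: ca].
by apply: (@continuous_comp _ _ _ snd b); [exact: cvg_snd|exact: cb].
Qed.

Lemma derivable_tensor a b (e : bool) z : smooth1 a -> smooth1 b ->
  derivable (tensor a b) z (dir e).
Proof.
case: z => x y sa sb; case: e => /=.
  apply/derivable_dir1; rewrite (_ : (fun s => _) = (fun s => b y * a s)).
    by apply: derivableZ; exact: smooth1_derivable.
  by apply/funext => s; rewrite /tensor mulrC.
apply/derivable_dir2; rewrite (_ : (fun s => _) = (fun s => a x * b s))//.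
by apply: derivableZ; exact: smooth1_derivable.
Qed.

Lemma partial1_tensor a b : smooth1 a -> partial1 (tensor a b) = tensor (derive1 a) b.
Proof.
move=> sa; apply/funext => -[x y]; rewrite partial1E.
rewrite (_ : (fun s => _) = (fun s => b y * a s)).
  by rewrite derive1E (deriveZ _ (@smooth1_derivable _ x sa)) -derive1E /GRing.scale/= mulrC.
by apply/funext => s; rewrite /tensor mulrC.
Qed.

Lemma partial2_tensor a b : smooth1 b -> partial2 (tensor a b) = tensor a (derive1 b).
Proof.
move=> sb; apply/funext => -[x y]; rewrite partial2E.
rewrite (_ : (fun s => _) = (fun s => a x * b s))//.
by rewrite derive1E (deriveZ _ (@smooth1_derivable _ y sb)) -derive1E.
Qed.

Lemma smooth_tensor a b : smooth1 a -> smooth1 b -> smooth (tensor a b).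
Proof.
move=> sa sb s.
suff [a' [b' [sa' sb' ->]]] : exists a' b', [/\ smooth1 a', smooth1 b' &
    iter_partial s (tensor a b) = tensor a' b'].
  split; first by apply: continuous_tensor; exact: smooth1_continuous.
  move=> z; split; first exact: (@derivable_tensor _ _ true).
  exact: (@derivable_tensor _ _ false).
elim: s => [|e s [a' [b' [sa' sb' E]]]]; first by exists a, b.
rewrite /= -/(iter_partial s _) E; case: e.
  exists (derive1 a'), b'; rewrite partial1_tensor//; split => //.
  exact: smooth1_derive.
exists a', (derive1 b'); rewrite partial2_tensor//; split => //.
exact: smooth1_derive.
Qed.

Lemma smooth_C1 e f : smooth f -> C1 e f.
Proof.
move=> sf; have [cf df] := sf [::]; have [cdf _] := sf [:: e].
split; [exact: cf| |by case: e cdf => cdf; exact: cdf].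
move=> x; have [d1 d2] := df x.
by case: e {cdf}; rewrite /dir; [exact d1|exact d2].
Qed.

Lemma smooth_continuous f : smooth f -> continuous f.
Proof. by move=> /(_ [::])[]. Qed.

Lemma test_function_out u z : test_function u -> ~ @Omega R z -> u z = 0.
Proof. by move=> [_ [K [_ KO uK]]] zO; apply: uK => /KO. Qed.

(** A test function vanishes on the boundary of [Omega]; sides of [rect c d]
    inside [Omega] require that [f] vanishes there. *)
Lemma test_function_vanishes e c d u f : test_function u ->
  (if e then True else
    (c = 0 \/ forall x, f (x, c) = 0) /\ (d = 1 \/ forall x, f (x, d) = 0)) ->
  vanishes_on_sides e c d (u \* f).
Proof.
move=> tu; have u0 x y : ~ (0 < x < 1 /\ 0 < y < 1) -> u (x, y) = 0.
  by move=> H; apply: test_function_out => //; rewrite /Omega/= !in_itv.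
case: e => [_ y _|[hc hd] x _].
  by split; rewrite /= u0 ?mul0r// ltxx ?andbF => -[].
split => /=; [case: hc => [->|->]|case: hd => [->|->]]; rewrite ?mulr0//.
  by rewrite u0 ?mul0r// ltxx => -[].
by rewrite u0 ?mul0r// ltxx andbF => -[].
Qed.

Lemma cvg_E_cst f : cvg_E (fun=> f) f.
Proof.
rewrite /cvg_E (_ : EFin \o _ = cst 0%E); last first.
  by apply/funext => z; rewrite /= patchE /= subrr; case: ifP.
by rewrite Lnorm0//; exact: cvg_cst.
Qed.

Lemma innerE_rect f g :
  innerE f g = \int[leb2]_(z in rect 0 1) (f z * g z).
Proof. by []. Qed.

Lemma nabla_test u : test_function u -> nabla u (partial1 u, partial2 u).
Proof.
move=> tu; have [su _] := tu.
have [c1 _ d1] := smooth_C1 true su; have [_ _ d2] := smooth_C1 false su.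
split.
- exact: (continuous_in_E c1).
- split; [exact (continuous_in_E d1)|exact (continuous_in_E d2)].
- move=> v tv; have [sv _] := tv; split.
    have T : vanishes_on_sides true 0 1 (u \* v).
      exact: (@test_function_vanishes true).
    have := integration_by_parts_rect ltr01 (smooth_C1 true su) (smooth_C1 true sv) T.
    by rewrite /partial !innerE_rect => ->.
  have T : vanishes_on_sides false 0 1 (u \* v).
    by apply: (@test_function_vanishes false) => //; split; left.
  have := integration_by_parts_rect ltr01 (smooth_C1 false su) (smooth_C1 false sv) T.
  by rewrite /partial !innerE_rect => ->.
- exists (fun=> u); split; [by []|exact: cvg_E_cst..].
Qed.

Lemma in_E_eq f f' : (forall z, @Omega R z -> f z = f' z) -> in_E f -> in_E f'.
Proof.
rewrite /in_E => ff'; rewrite (_ : f \_ (@Omega R) = f' \_ (@Omega R))//.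
by apply/funext => z; rewrite !patchE; case: ifPn => // /set_mem; exact: ff'.
Qed.

Lemma eq_nabla_adj (p p' : (R * R -> R) * (R * R -> R)) w w' :
  (forall z, @Omega R z -> p.1 z = p'.1 z) ->
  (forall z, @Omega R z -> p.2 z = p'.2 z) ->
  (forall z, @Omega R z -> w z = w' z) -> nabla_adj p w -> nabla_adj p' w'.
Proof.
move=> E1 E2 Ew [[p1E p2E] wE H]; split;
  [split; [exact: in_E_eq E1 p1E|exact: in_E_eq E2 p2E]|exact: in_E_eq Ew wE|].
move=> y g yg; rewrite -(eq_innerE (fun _ _ => erefl) Ew) -(H _ _ yg).
congr (_ + _); apply/esym; first exact: (eq_innerE (fun _ _ => erefl) E1).
exact: (eq_innerE (fun _ _ => erefl) E2).
Qed.

Lemma innerE_patch_rect f g c d : 0 <= c -> d <= 1 ->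
  innerE f (g \_ (rect c d)) = \int[leb2]_(z in rect c d) (f z * g z).
Proof.
move=> c0 d1; rewrite /innerE Rintegral_mkcond [RHS]Rintegral_mkcond.
congr fine; apply: eq_integral => z _; congr EFin; rewrite !patchE.
case: ifPn => zO; case: ifPn => zr //; rewrite ?mulr0//.
by case/negP: zO; apply/mem_set/(rect_sub_Omega c0 d1)/set_mem.
Qed.

Lemma patch_rect_in_E f c d : continuous f -> in_E (f \_ (rect c d)).
Proof.
move=> cf; apply: bounded_in_E.
  apply: (measurable_restrictT _ (measurable_rect c d)).1.
  by apply: (@measurable_funTS _ _ plane R); exact: continuous_measurable2.
have [M M0 fM] := continuous_bounded_rect 0 1 cf; exists M => z Oz.
by rewrite patchE; case: ifP => _; [exact: fM|rewrite normr0 ltW].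
Qed.

Definition divergence (p : (R * R -> R) * (R * R -> R)) : R * R -> R :=
  partial1 p.1 \+ partial2 p.2.

(** The restriction to [rect c d] of a field whose normal component vanishes on
    the sides interior to [Omega] is in the domain of the adjoint, because
    integration by parts against a test function leaves no boundary term.  The
    identity passes to [H_0^1] by density of the test functions. *)
Lemma nabla_adj_rect (p : (R * R -> R) * (R * R -> R)) c d :
  0 <= c -> c < d -> d <= 1 -> C1 true p.1 -> C1 false p.2 ->
  (c = 0 \/ forall x, p.2 (x, c) = 0) -> (d = 1 \/ forall x, p.2 (x, d) = 0) ->
  nabla_adj (chi_adj_chi (rect c d) p)
            ((fun z => - divergence p z) \_ (rect c d)).
Proof.
move=> c0 cd d1 C1p C2p pc pd.
have [cp1 _ dp1] := C1p; have [cp2 _ dp2] := C2p.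
have cdiv : continuous (fun z => - divergence p z).
  by move=> z; apply: cvgN; apply: cvgD; [exact: dp1|exact: dp2].
have Ew := patch_rect_in_E c d cdiv.
have E1 := patch_rect_in_E c d cp1; have E2 := patch_rect_in_E c d cp2.
split => //; move=> y g [yE [g1E g2E] _ [u [tu uy u1 u2]]].
have su n : smooth (u n) by case: (tu n).
have Cu e n : C1 e (u n) by exact: smooth_C1.
have Eu n : in_E (u n) by apply: continuous_in_E; case: (Cu true n).
have Edu e n : in_E (partial e (u n)) by apply: continuous_in_E; case: (Cu e n).
have key n : innerE (partial1 (u n)) (p.1 \_ (rect c d)) +
    innerE (partial2 (u n)) (p.2 \_ (rect c d)) =
    innerE (u n) ((fun z => - divergence p z) \_ (rect c d)).
  rewrite !innerE_patch_rect//.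
  have T1 : vanishes_on_sides true c d (u n \* p.1).
    exact: (@test_function_vanishes true).
  have T2 : vanishes_on_sides false c d (u n \* p.2).
    exact: (@test_function_vanishes false).
  have := integration_by_parts_rect cd (Cu true n) C1p T1.
  move=> /(congr1 -%R); rewrite opprK /partial => <-.
  have := integration_by_parts_rect cd (Cu false n) C2p T2.
  move=> /(congr1 -%R); rewrite opprK /partial => <-.
  have i1 := continuous_integrable_rect c d (continuousM2 (smooth_continuous (su n)) dp1).
  have i2 := continuous_integrable_rect c d (continuousM2 (smooth_continuous (su n)) dp2).
  rewrite -opprD -(@RintegralD _ plane _ leb2 _ _ _ (measurable_rect c d) i1 i2).
  rewrite -mulN1r -(@RintegralZl _ plane _ leb2)//; last 2 first.
  - exact: measurable_rect.
  - exact: (@integrableD _ plane _ leb2 _ (measurable_rect c d) _ _ i1 i2).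
  by apply: eq_Rintegral => z _; rewrite /divergence /=; ring.
have L1 : (fun n => innerE (partial1 (u n)) (p.1 \_ (rect c d)) +
    innerE (partial2 (u n)) (p.2 \_ (rect c d))) @ \oo -->
    innerE2 g (chi_adj_chi (rect c d) p).
  apply: cvgD; apply: cvg_innerE => //.
  - exact: (Edu true).
  - exact: (Edu false).
have L2 := cvg_innerE Eu yE Ew uy.
rewrite (funext key) in L1.
exact: (cvg_unique _ L1 L2).
Qed.

End TestFunctions.
(** * Uniqueness of the image under the adjoint *)

Section Cutoff.
Context {R : realType}.
Implicit Types (f u w : R * R -> R) (a b : R -> R) (s : R) (n : nat).
Local Notation mu := (@lebesgue_measure R).
Local Notation leb2 := (mu \x mu)%E.
Local Notation Rm := (g_sigma_algebraType (R.-ocitv.-measurable)).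
Local Notation plane := (Rm * Rm)%type.

(** The product of [flat 0] at [(n+1) s - 1] and at [(n+1) (1-s) - 1]: it is
    supported in [[1/(n+1), 1 - 1/(n+1)]], has values in [[0,1]], and tends
    to [1] on [(0,1)] since both arguments tend to infinity. *)
Definition cutoff n s : R :=
  flat 0 (n.+1%:R * s + (-1)) * flat 0 ((- n.+1%:R) * s + n%:R).

Lemma smooth1_cutoff n : smooth1 (cutoff n).
Proof.
move=> k; apply: derivable_timesM; apply: derivable_times_affine;
  exact: derivable_times_flat.
Qed.

Lemma cutoff_ge0 n s : 0 <= cutoff n s.
Proof. by rewrite mulr_ge0 ?flat_ge0. Qed.

Lemma cutoff_le1 n s : cutoff n s <= 1.
Proof. by rewrite mulr_ile1 ?flat_ge0 ?flat0_le1. Qed.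

Lemma cutoff_eq0 n s : ~ (n.+1%:R^-1 <= s <= 1 - n.+1%:R^-1) -> cutoff n s = 0.
Proof.
have n0 : (0 : R) < n.+1%:R by rewrite ltr0n.
move=> H; rewrite /cutoff {1}/flat; case: ifPn => h1; last by rewrite mul0r.
rewrite /flat; case: ifPn => h2; last by rewrite mulr0.
exfalso; apply: H.
have E : n%:R = n.+1%:R - 1 :> R by rewrite -natr1 addrK.
have V : n.+1%:R * n.+1%:R^-1 = 1 :> R by rewrite divff// gt_eqF.
rewrite -(ler_pM2l n0) -[X in _ && X](ler_pM2l n0) mulrBr V mulr1.
by apply/andP; split; lra.
Qed.

Lemma cvg_cutoff s : 0 < s < 1 -> cutoff n s @[n --> \oo] --> (1 : R).
Proof.
move=> /andP[s0 s1].
have lin (t r : R) : 0 < t -> (n.+1%:R * t + r) @[n --> \oo] --> +oo%R.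
  move=> t0; apply/cvgryPge => M; near=> n.
  rewrite -lerBlDr -ler_pdivrMr//.
  rewrite (@le_trans _ _ n%:R) ?ler_nat//.
  by near: n; exact: nbhs_infty_ger.
suff : cutoff n s @[n --> \oo] --> (1 * 1 : R) by rewrite mulr1.
apply: cvgM; first exact: (cvg_comp _ _ (lin _ _ s0) cvg_flat0).
have s1' : 0 < 1 - s by rewrite subr_gt0.
rewrite (_ : (fun n => _) = (fun n => flat 0 (n.+1%:R * (1 - s) + (-1)))).
  exact: (cvg_comp _ _ (lin _ _ s1') cvg_flat0).
by apply/funext => n; congr (flat _ _); rewrite -natr1; ring.
Unshelve. all: by end_near. Qed.

Lemma test_function_tensor_cutoff a b n : smooth1 a -> smooth1 b ->
  test_function (tensor (a \* cutoff n) (b \* cutoff n)).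
Proof.
move=> sa sb; split.
  by apply: smooth_tensor; apply: smooth1M => //; exact: smooth1_cutoff.
have n0 : (0 : R) < n.+1%:R^-1 by rewrite invr_gt0 ltr0n.
pose I : set R := `[n.+1%:R^-1, 1 - n.+1%:R^-1]%classic.
have IE s : I s = (n.+1%:R^-1 <= s <= 1 - n.+1%:R^-1) by rewrite /I /= in_itv.
exists (I `*` I); split.
- by apply: compact_setX; exact: segment_compact.
- move=> [x y] /= []; rewrite !IE => /andP[x1 x2] /andP[y1 y2].
  have lt1 : 1 - n.+1%:R^-1 < 1 :> R by rewrite ltrBlDr ltrDl.
  split; rewrite /= in_itv/=.
    by rewrite (lt_le_trans n0 x1) (le_lt_trans x2 lt1).
  by rewrite (lt_le_trans n0 y1) (le_lt_trans y2 lt1).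
- move=> [x y] /= xy; rewrite /tensor/=.
  have [Ix|Ix] := pselect (I x); last first.
    by rewrite (@cutoff_eq0 _ x) ?mulr0 ?mul0r// -IE.
  have [Iy|Iy] := pselect (I y); first by case: xy.
  by rewrite (@cutoff_eq0 _ y) ?mulr0// -IE.
Qed.

(** Dominated convergence with dominating function [|tensor a b * w|], as the
    cutoffs tend to [1] at every point of the open square. *)
Lemma cvg_innerE_cutoff a b w : smooth1 a -> smooth1 b -> in_E w ->
  innerE (tensor (a \* cutoff n) (b \* cutoff n)) w @[n --> \oo] -->
  innerE (tensor a b) w.
Proof.
move=> sa sb wE.
have ct : continuous (tensor a b).
  by apply: continuous_tensor; exact: smooth1_continuous.
have Et : in_E (tensor a b) by exact: continuous_in_E.
have Eu n : in_E (tensor (a \* cutoff n) (b \* cutoff n)).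
  have [+ _] := test_function_tensor_cutoff n sa sb.
  by move=> /smooth_continuous; exact: continuous_in_E.
have it := in_E_mulr_integrable Et wE.
have iu n := in_E_mulr_integrable (Eu n) wE.
pose F n := EFin \o (tensor (a \* cutoff n) (b \* cutoff n) \* w).
have ptw z : @Omega R z -> F n z @[n --> \oo] --> (EFin \o (tensor a b \* w)) z.
  case: z => x y [] /=; rewrite !in_itv/= => x01 y01.
  apply: cvg_EFin; first by near=> n.
  apply: cvgM; last exact: cvg_cst.
  suff : (a x * cutoff n x * (b y * cutoff n y)) @[n --> \oo] -->
      (a x * 1 * (b y * 1)) by rewrite !mulr1.
  by apply: cvgM; apply: cvgM; (exact: cvg_cst || exact: cvg_cutoff).
have dom z n : (`|F n z| <= (abse \o (EFin \o (tensor a b \* w)%R)) z)%E.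
  rewrite /F /= lee_fin /tensor/= !normrM ler_wpM2r//.
  have nc' s : `|flat 0 (n.+1%:R * s + (-1))| *
      `|flat 0 ((- n.+1%:R) * s + n%:R)| <= 1.
    by rewrite -normrM -/(cutoff n s) ger0_norm ?cutoff_ge0 ?cutoff_le1.
  by apply: ler_pM; rewrite ?mulr_ge0//; apply: ler_piMr; rewrite ?nc'.
have [_ _ L] := @dominated_convergence _ plane _ leb2 _ measurable_Omega
  F (EFin \o (tensor a b \* w)) (abse \o (EFin \o (tensor a b \* w)))
  (fun n => measurable_int _ (iu n)) (measurable_int _ it)
  (@aeW _ plane R leb2 _ ptw) (@integrable_abse _ plane _ leb2 _ _ it)
  (@aeW _ plane R leb2 _ (fun z n _ => dom z n)).
have Lfin : (\int[leb2]_(z in @Omega R) (EFin \o (tensor a b \* w)%R) z)%E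
    = (innerE (tensor a b) w)%:E.
  by rewrite /innerE /Rintegral fineK//; apply: (integrable_fin_num measurable_Omega it).
rewrite Lfin in L; exact: (fine_cvg L).
Unshelve. all: by end_near. Qed.

Lemma tensor_inner_unique a b w w' : smooth1 a -> smooth1 b ->
  in_E w -> in_E w' ->
  (forall u, test_function u -> innerE u w = innerE u w') ->
  innerE (tensor a b) w = innerE (tensor a b) w'.
Proof.
move=> sa sb wE wE' H.
have L := cvg_innerE_cutoff sa sb wE.
have L' := cvg_innerE_cutoff sa sb wE'.
rewrite (funext (fun n => H _ (test_function_tensor_cutoff n sa sb))) in L.
exact: (cvg_unique _ L L').
Qed.

(** Test functions belong to the domain of the gradient, so their inner
    products with two images of the same field agree, and [tensor a b] is
    approximated by test functions. *)
Lemma nabla_adj_inner_unique p w w' a b : smooth1 a -> smooth1 b ->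
  nabla_adj p w -> nabla_adj p w' ->
  innerE w (tensor a b) = innerE w' (tensor a b).
Proof.
move=> sa sb [_ wE pw] [_ wE' pw']; rewrite !(innerEC _ (tensor a b)).
apply: tensor_inner_unique => // u tu.
by rewrite -(pw _ _ (nabla_test tu)) -(pw' _ _ (nabla_test tu)).
Qed.

End Cutoff.
(** * The output series for the given field *)

Section Trig.
Context {R : realType}.
Implicit Types (a b A B : R -> R) (c d p q r s x : R) (i j k m n : nat).
Local Notation mu := (@lebesgue_measure R).
Local Notation leb2 := (mu \x mu)%E.

Lemma is_derive_scale c (f : R -> R) (x df : R) : is_derive x 1 f df ->
  is_derive x 1 (fun s => c * f s) (c * df).
Proof. by move=> H; apply: is_deriveZ. Qed.

Lemma is_derive_mull c x : is_derive x 1 (fun s : R => c * s) c.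
Proof.
by apply: is_derive_eq; rewrite /GRing.scale/= mulr1.
Qed.

Lemma is_derive_sin_mull c x :
  is_derive x 1 (fun s => sin (c * s)) (c * cos (c * x)).
Proof.
rewrite mulrC; apply: (@is_derive1_comp _ sin (fun s => c * s)).
exact: is_derive_mull.
Qed.

Lemma is_derive_cos_mull c x :
  is_derive x 1 (fun s => cos (c * s)) (- (c * sin (c * x))).
Proof.
rewrite mulrC -mulNr; apply: (@is_derive1_comp _ cos (fun s => c * s)).
exact: is_derive_mull.
Qed.

Lemma smooth1_sin_mull c : smooth1 (fun s => sin (c * s)).
Proof.
move=> n; rewrite (_ : (fun s => _) = (fun s => sin (c * s + 0))).
  by apply: derivable_times_affine; have [] := @derivable_times_sin_cos R n.
by apply/funext => s; rewrite addr0.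
Qed.

Lemma smooth1_cos_mull c : smooth1 (fun s => cos (c * s)).
Proof.
move=> n; rewrite (_ : (fun s => _) = (fun s => cos (c * s + 0))).
  by apply: derivable_times_affine; have [] := @derivable_times_sin_cos R n.
by apply/funext => s; rewrite addr0.
Qed.

Lemma smooth1Z c a : smooth1 a -> smooth1 (fun s => c * a s).
Proof. by move=> sa n; exact: derivable_timesZ. Qed.

(** A primitive of [cos (r s)], including the resonant case [r = 0]. *)
Definition cos_prim r s : R := if r == 0 then s else sin (r * s) / r.

Lemma is_derive_cos_prim r s : is_derive s 1 (cos_prim r) (cos (r * s)).
Proof.
have [->|r0] := eqVneq r 0.
  rewrite mul0r cos0 (_ : cos_prim 0 = id); first exact: is_derive_id.
  by apply/funext => t; rewrite /cos_prim eqxx.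
rewrite (_ : cos_prim r = (fun s => r^-1 * sin (r * s))).
  by have := is_derive_scale r^-1 (is_derive_sin_mull r s); rewrite mulKf.
by apply/funext => t; rewrite /cos_prim (negbTE r0) mulrC.
Qed.

Definition sin_sin_prim p q s : R := 2^-1 * (cos_prim (p - q) s - cos_prim (p + q) s).

Lemma is_derive_sin_sin_prim p q s :
  is_derive s 1 (sin_sin_prim p q) (sin (p * s) * sin (q * s)).
Proof.
have := is_derive_scale 2^-1
  (is_deriveB (is_derive_cos_prim (p - q) s) (is_derive_cos_prim (p + q) s)).
by move/is_derive_eq; apply; rewrite mulrBl mulrDl cosB cosD; field.
Qed.

Lemma sin_natpi k : sin (k%:R * pi) = 0 :> R.
Proof.
elim: k => [|k IH]; first by rewrite mul0r sin0.
by rewrite -natr1 mulrDl mul1r sinDpi IH oppr0.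
Qed.

Lemma cos_prim0 r : cos_prim r 0 = 0.
Proof. by rewrite /cos_prim mulr0 sin0 mul0r; case: ifP. Qed.

Lemma sin_sin_prim0 p q : sin_sin_prim p q 0 = 0.
Proof. by rewrite /sin_sin_prim !cos_prim0 subrr mulr0. Qed.

Lemma sin_sin_prim1 m n : (0 < n)%N ->
  sin_sin_prim (m%:R * pi) (n%:R * pi) 1 = if m == n then 2^-1 else 0.
Proof.
move=> n0; have pi0 : pi != 0 :> R by rewrite gt_eqF// pi_gt0.
rewrite /sin_sin_prim -mulrDl -natrD {2}/cos_prim mulr1 sin_natpi mul0r.
rewrite ifF ?subr0; last first.
  by rewrite mulf_eq0 (negbTE pi0) orbF pnatr_eq0 addn_eq0 (gtn_eqF n0) andbF.
rewrite -mulrBl /cos_prim mulr1 mulf_eq0 (negbTE pi0) orbF subr_eq0 eqr_nat.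
case: eqP => [_|mn]; first by rewrite mulr1.
rewrite mulrBl sinB !sin_natpi mulr0 mul0r subrr mul0r mulr0.
by [].
Qed.

Lemma continuous_sin_sin p q : continuous (fun s : R => sin (p * s) * sin (q * s)).
Proof. by apply: smooth1_continuous; apply: smooth1M; exact: smooth1_sin_mull. Qed.

Lemma Rintegral_rect_tensor a b A B c d : c < d -> continuous a -> continuous b ->
  (forall x : R, is_derive x 1 A (a x)) -> (forall x : R, is_derive x 1 B (b x)) ->
  \int[leb2]_(z in rect c d) (tensor a b z) = (A 1 - A 0) * (B d - B c).
Proof.
move=> cd ca cb dA dB.
rewrite Rintegral_rect12; last first.
  by apply: continuous_integrable_rect; exact: continuous_tensor.
have cZ r (f : R -> R) : continuous f -> continuous (fun s => r * f s).
  by move=> cf s; apply: cvgM; [exact: cvg_cst|exact: cf].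
have inner x : (\int[mu]_(y in `]c, d[) (a x * b y)%:E =
    ((B d - B c) * a x)%:E)%E.
  rewrite (integral_oo_FTC cd (cZ (a x) _ cb) (fun y => is_derive_scale (a x) (dB y))).
  by congr EFin; ring.
have -> : (\int[mu]_(x in `]0%R, 1%R[) \int[mu]_(y in `]c, d[) (tensor a b (x, y))%:E =
    \int[mu]_(x in `]0%R, 1%R[) ((B d - B c) * a x)%:E)%E.
  by apply: eq_integral => x _; exact: inner.
rewrite (integral_oo_FTC ltr01 (cZ (B d - B c) _ ca)
  (fun x => is_derive_scale (B d - B c) (dA x))) /=.
by ring.
Qed.

Lemma Rintegral_sin_sin p q :
  \int[mu]_(s in `[0, 1]) (sin (p * s) * sin (q * s)) = sin_sin_prim p q 1.
Proof.
rewrite /Rintegral (@integral_itv_bndoo _ 0 1 _ true false); last first.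
  apply/measurable_EFinP; apply: measurable_funTS.
  by apply: continuous_measurable_fun; exact: continuous_sin_sin.
rewrite (integral_oo_FTC ltr01 (@continuous_sin_sin p q) (is_derive_sin_sin_prim p q)).
by rewrite sin_sin_prim0 subr0.
Qed.

Lemma output_phi i j :
  output (@phi R i j) = 2 * sin (i%:R * pi * 2^-1) * (if j == 2 then 2^-1 else 0).
Proof.
have -> : @output R (phi i j) = \int[mu]_(s in `[0, 1])
    (2 * sin (i%:R * pi * 2^-1) * (sin (j%:R * pi * s) * sin (2%:R * pi * s))).
  by rewrite /output; apply: eq_Rintegral => s _; rewrite /phi/= mulrA.
rewrite RintegralZl//.
  by rewrite Rintegral_sin_sin sin_sin_prim1.
apply: continuous_compact_integrable; first exact: segment_compact.
by apply: continuous_subspaceT; exact: continuous_sin_sin.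
Qed.

Lemma phi_tensor i j : @phi R i j =
  tensor (fun s => 2 * sin (i%:R * pi * s)) (fun s => sin (j%:R * pi * s)).
Proof. by []. Qed.

Definition opp_div_h : R * R -> R :=
  tensor (fun s => 2^-1 * sin (pi * s)) (fun s => sin (4 * pi * s)).

Lemma innerE_opp_div_h_phi c d i j : 0 <= c -> c < d -> d <= 1 -> (0 < i)%N ->
  innerE (opp_div_h \_ (rect c d)) (phi i j) =
  (if i == 1%N then 2^-1 else 0) *
  (sin_sin_prim (4%:R * pi) (j%:R * pi) d - sin_sin_prim (4%:R * pi) (j%:R * pi) c).
Proof.
move=> c0 cd d1 i0; rewrite innerEC innerE_patch_rect//.
rewrite eq_sym -(@sin_sin_prim1 1 i i0) -[X in X * _]subr0.
rewrite -[X in (_ - X) * _](sin_sin_prim0 (1%:R * pi) (i%:R * pi)).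
rewrite -(Rintegral_rect_tensor cd (@continuous_sin_sin _ _) (@continuous_sin_sin _ _)
  (is_derive_sin_sin_prim _ _) (is_derive_sin_sin_prim _ _)).
by apply: eq_Rintegral => z _; rewrite /phi /opp_div_h /tensor/= mul1r; field.
Qed.

Lemma derive1_cos_mull c : derive1 (fun s : R => cos (c * s)) = (fun s => - (c * sin (c * s))).
Proof.
apply/funext => x; rewrite derive1E.
by rewrite (@derive_val _ _ _ _ _ _ _ (is_derive_cos_mull c x)).
Qed.

Lemma derive1_scale c a : smooth1 a -> derive1 (fun s => c * a s) = (fun s => c * derive1 a s).
Proof.
move=> sa; apply/funext => x; rewrite !derive1E.
have H := is_derive_scale c (derivableP (@smooth1_derivable _ _ x sa)).
by rewrite (@derive_val _ _ _ _ _ _ _ H).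
Qed.

Definition cos_pi : R -> R := fun s => (4 * pi)^-1 * cos (pi * s).
Definition sin_pi : R -> R := fun s => (4 * pi)^-1 / 4 * sin (pi * s).
Definition sin_4pi : R -> R := fun s => sin (4 * pi * s).
Definition cos_4pi : R -> R := fun s => cos (4 * pi * s).

Lemma h1E : (h R).1 = tensor cos_pi sin_4pi.
Proof. by apply/funext => z; rewrite /tensor /= mulrA. Qed.

Lemma h2E : (h R).2 = tensor sin_pi cos_4pi.
Proof. by apply/funext => z; rewrite /tensor /= !mulrA. Qed.

Lemma smooth_h1 : smooth (h R).1.
Proof.
rewrite h1E; apply: smooth_tensor; last exact: smooth1_sin_mull.
by apply: smooth1Z; exact: smooth1_cos_mull.
Qed.

Lemma smooth_h2 : smooth (h R).2.
Proof.
rewrite h2E; apply: smooth_tensor; last exact: smooth1_cos_mull.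
by apply: smooth1Z; exact: smooth1_sin_mull.
Qed.

Lemma opp_divergence_h z : - divergence (h R) z = opp_div_h z.
Proof.
have pi0 : pi != 0 :> R by rewrite gt_eqF// pi_gt0.
rewrite /divergence h1E h2E partial1_tensor; last first.
  by apply: smooth1Z; exact: smooth1_cos_mull.
rewrite partial2_tensor; last exact: smooth1_cos_mull.
rewrite /tensor /cos_pi derive1_scale; last exact: smooth1_cos_mull.
rewrite /cos_4pi !derive1_cos_mull /sin_pi /sin_4pi /opp_div_h /tensor /=.
by move: (pi : R) pi0 => q q0; field.
Qed.

(** The only conditions come from the factor [cos (4 pi y2)] of the second
    component of [h] on the sides interior to [Omega]. *)
Lemma nabla_adj_h_rect c d : 0 <= c -> c < d -> d <= 1 ->
  c = 0 \/ cos (4 * pi * c) = 0 -> d = 1 \/ cos (4 * pi * d) = 0 ->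
  nabla_adj (chi_adj_chi (rect c d) (h R)) (opp_div_h \_ (rect c d)).
Proof.
move=> c0 cd d1 hc hd; rewrite -(funext opp_divergence_h).
have h20 s : cos (4 * pi * s) = 0 -> forall x, (h R).2 (x, s) = 0.
  by move=> s0 x; rewrite /= s0 !mulr0.
apply: nabla_adj_rect => //.
- by apply: smooth_C1; exact: smooth_h1.
- by apply: smooth_C1; exact: smooth_h2.
- by case: hc => [->|/h20]; [left|right].
- by case: hd => [->|/h20]; [left|right].
Qed.

Lemma Kalpha_term_eq0 t w i j : (0 < i)%N ->
  (forall i, (1 < i)%N -> innerE w (phi i 2) = 0) -> (i, j) != (1, 2)%N ->
  mittag_leffler 2^-1 (- (lambda R i j * t `^ 2^-1)) * innerE w (phi i j) *
    output (phi i j) = 0.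
Proof.
move=> i0 Hw; rewrite output_phi; case: (eqVneq j 2%N) => [->|_ _]; last by rewrite !mulr0.
rewrite xpair_eqE eqxx andbT => i1.
by rewrite Hw ?mulr0 ?mul0r// ltn_neqAle eq_sym i1.
Qed.

Lemma K_partialE t w m n : (0 < m)%N -> (1 < n)%N ->
  (forall i, (1 < i)%N -> innerE w (phi i 2) = 0) ->
  K_partial 2^-1 t w (m, n) =
  mittag_leffler 2^-1 (- (lambda R 1 2 * t `^ 2^-1)) * innerE w (phi 1 2).
Proof.
move=> m0 n1 Hw; rewrite /K_partial /=.
rewrite big_ltn ?ltnS// [X in _ + X]big_nat_cond [X in _ + X]big1 ?addr0; last first.
  move=> i /andP[/andP[i1 _] _]; rewrite big_nat_cond big1// => j /andP[/andP[j0 _] _].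
  apply: Kalpha_term_eq0 => //; first by rewrite (ltn_trans _ i1).
  by rewrite xpair_eqE (gtn_eqF i1).
rewrite big_ltn ?ltnS ?(ltnW n1)// Kalpha_term_eq0// add0r.
rewrite big_ltn ?ltnS// [X in _ + X]big_nat_cond [X in _ + X]big1 ?addr0; last first.
  move=> j /andP[/andP[j1 _] _].
  by apply: Kalpha_term_eq0 => //; rewrite xpair_eqE (gtn_eqF j1).
rewrite output_phi/= mul1r sin_pihalf.
by rewrite mulr1 divff ?mulr1.
Qed.

(** When [w] is orthogonal to [phi i 2] for [i > 1], only the index [(1, 2)]
    survives, because the output of [phi i j] vanishes for [j != 2]; the
    partial sums are constant from there on. *)
Lemma cvg_Kalpha t w :
  (forall i, (1 < i)%N -> innerE w (phi i 2) = 0) ->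
  Kalpha 2^-1 t w
    (mittag_leffler 2^-1 (- (lambda R 1 2 * t `^ 2^-1)) * innerE w (phi 1 2)).
Proof.
move=> Hw; apply: cvg_near_cst.
exists ([set m | (0 < m)%N], [set n | (1 < n)%N]).
  by split; [exists 1%N|exists 2%N].
by move=> [m n] [/= m0 n1]; exact: K_partialE.
Qed.

(** The integral of [sin (4 pi s) sin (2 pi s)] over [(1/8, 5/8)]: with
    [r = sin (pi / 4)] it is [- r / (3 pi)], since the arguments at the two
    ends reduce to [pi / 4] modulo [pi] up to sign. *)
Lemma sin_sin_prim_omega_neq0 :
  sin_sin_prim (4%:R * pi) (2%:R * pi) (5 / 8) -
  sin_sin_prim (4%:R * pi) (2%:R * pi) 8^-1 != 0 :> R.
Proof.
have pi0 : pi != 0 :> R by rewrite gt_eqF// pi_gt0.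
pose r : R := sin (pi / 4).
have r0 : r != 0.
  rewrite gt_eqF// sin_gt0_pi//.
  by rewrite divr_gt0 ?pi_gt0//= ltr_pdivrMr// ltr_pMr ?pi_gt0// ltr1n.
have arg m s x : (m%:R * pi * s = x :> R) -> m%:R * pi != 0 :> R ->
    cos_prim (m%:R * pi) s = sin x / (m%:R * pi).
  by move=> sx m0; rewrite /cos_prim (negbTE m0) sx.
have m0 m : (m.+1%:R * pi != 0 :> R) by rewrite mulf_neq0// pnatr_eq0.
have E2 s : sin_sin_prim (4%:R * pi) (2%:R * pi) s =
    2^-1 * (cos_prim (2%:R * pi) s - cos_prim (6%:R * pi) s).
  by rewrite /sin_sin_prim -mulrBl -mulrDl -natrD -natrB.
have a1 : 2%:R * pi * (5 / 8) = pi / 4 + pi :> R by field.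
have a2 : 2%:R * pi * 8^-1 = pi / 4 :> R by field.
have a3 : 6%:R * pi * (5 / 8) = - (pi / 4) + pi + pi + pi + pi :> R by field.
have a4 : 6%:R * pi * 8^-1 = - (pi / 4) + pi :> R by field.
rewrite !E2 (arg _ _ _ a1)// (arg _ _ _ a2)// (arg _ _ _ a3)// (arg _ _ _ a4)//.
rewrite !sinDpi sinN -/r.
have -> : 2^-1 * (- r / (2%:R * pi) - - - - - - r / (6%:R * pi)) -
    2^-1 * (r / (2%:R * pi) - - - r / (6%:R * pi)) = - (r / (3 * pi)).
  by clearbody r; move: (pi : R) pi0 => q q0; field.
by rewrite oppr_eq0 mulf_neq0// invr_eq0.
Qed.

End Trig.

Theorem proposition8 (R : realType) :
  not_approx_G_observable_Omega (2^-1 : R) 2 (h R) /\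
  approx_G_observable (2^-1 : R) 2 (omega R) (h R).
Proof.
have inner_div c d i : 0 <= c -> c < d -> d <= 1 -> (1 < i)%N ->
    innerE (opp_div_h \_ (rect c d)) (phi i 2) = 0 :> R.
  move=> c0 cd d1 i1; rewrite innerE_opp_div_h_phi ?(ltnW i1)//.
  by rewrite gtn_eqF// mul0r.
split=> t /andP[t0 _].
  have := @cvg_Kalpha _ t _ (fun i => @inner_div 0 1 i (lexx 0) ltr01 (lexx 1)).
  rewrite innerE_opp_div_h_phi ?ltr01// sin_sin_prim0 sin_sin_prim1//= subrr !mulr0 => K0.
  exists (opp_div_h \_ (rect 0 1)); split => //.
  have adj := nabla_adj_h_rect (lexx 0) (@ltr01 R) (lexx 1) (or_introl erefl) (or_introl erefl).
  apply: (eq_nabla_adj _ _ _ adj) => // z Oz; rewrite /= patchE mem_set//; exact: Oz.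
have c0 : (0 : R) <= 8^-1 by [].
have cd : (8^-1 : R) < 5 / 8 by lra.
have d1 : (5 / 8 : R) <= 1 by lra.
have hc : cos (4 * pi * 8^-1) = 0 :> R.
  by rewrite (_ : 4 * pi * 8^-1 = pi / 2) ?cos_pihalf//; field.
have hd : cos (4 * pi * (5 / 8)) = 0 :> R.
  rewrite (_ : 4 * pi * (5 / 8) = pi / 2 + pi + pi); last by field.
  by rewrite !cosDpi cos_pihalf !oppr0.
have adj := nabla_adj_h_rect c0 cd d1 (or_intror hc) (or_intror hd).
have Hw i := @inner_div _ _ i c0 cd d1.
have Kw := @cvg_Kalpha _ t _ Hw.
split; first by eexists; exists (opp_div_h \_ (omega R)); split; [exact: adj|exact: Kw].
move=> [w [adjw K0]].
(* the given image need not be the explicit one *)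
have ww i : innerE w (phi i 2) = innerE (opp_div_h \_ (rect 8^-1 (5 / 8))) (phi i 2).
  rewrite phi_tensor; apply: (nabla_adj_inner_unique _ _ adjw adj).
    by apply: smooth1Z; exact: smooth1_sin_mull.
  exact: smooth1_sin_mull.
have Hw' i : (1 < i)%N -> innerE w (phi i 2) = 0 by rewrite ww; exact: Hw.
have Kw' := @cvg_Kalpha _ t _ Hw'.
have : mittag_leffler 2^-1 (- (lambda R 1 2 * t `^ 2^-1)) * innerE w (phi 1 2) = 0.
  exact: (cvg_unique _ Kw' K0).
apply/eqP; rewrite ww innerE_opp_div_h_phi//= !mulf_neq0//.
  by rewrite gt_eqF// mittag_leffler_gt0// mulr_ge0 ?powR_ge0// mulr_ge0// sqr_ge0.
exact: sin_sin_prim_omega_neq0.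
Qed.
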